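(* There exist a computable basic sequence $Q=(q_n)_{n\ge1}$ and a computable real number $x$ such that $x\in[0,1)$ and $rx+s\in \mathcal{N}(Q)\setminus\mathcal{DN}(Q)$ for every $r\in\mathbb{Q}\setminus\{0\}$ and every $s\in\mathbb{Q}$.
   Context: A basic sequence is a sequence $Q=(q_n)_{n\ge1}$ of integers with $q_n\ge2$; it is computable if $n\mapsto q_n$ is a total recursive function. A real number $x$ is computable if for some integer $b\ge2$ there is a total recursive function computing the base-$b$ digits of $x$. Every real $x$ has a unique $Q$-Cantor series expansion $x=E_0+\sum_{n\ge1}\frac{E_n}{q_1\cdots q_n}$ with $E_0=\lfloor x\rfloor$, $E_n\in\{0,\dots,q_n-1\}$, $E_n\neq q_n-1$ infinitely often. A block of length $k$ is a $k$-tuple of non-negative integers; $N_n^Q(B,x)$ is the number of occurrences of $B$ as a consecutive block starting at some position $i\le n$ in $(E_i)$. Let $Q_n^{(k)}=\sum_{j=1}^n \frac{1}{q_j\cdots q_{j+k-1}}$. $x$ is $Q$-normal if for every $k\ge1$ and every block $B$ of length $k$, $N_n^Q(B,x)/Q_n^{(k)}\to1$; $\mathcal{N}(Q)$ is the set of $Q$-normal numbers. $x$ is $Q$-distribution normal if $((q_1\cdots q_n)x \bmod 1)_{n\ge0}$ is uniformly distributed mod $1$; $\mathcal{DN}(Q)$ is the set of these. *)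

(* Defs.v *)
From HB Require Import structures.
From mathcomp Require Import all_boot all_order all_algebra.
From mathcomp Require Import boolp classical_sets functions reals.
From mathcomp Require Import topology normedtype sequences.

Set Implicit Arguments.
Unset Strict Implicit.
Unset Printing Implicit Defensive.

Import Order.TTheory GRing.Theory Num.Theory.
Import numFieldNormedType.Exports.

Local Open Scope classical_set_scope.
Local Open Scope ring_scope.

(** Codes of k-ary partial (mu-)recursive functions. *)
Inductive recf : nat -> Type :=
| RZero k : recf k
| RSucc : recf 1
| RProj k (i : 'I_k) : recf k
| RComp m k (f : recf m) (g : 'I_m -> recf k) : recf k
| RPrec k (f : recf k) (g : recf k.+2) : recf k.+1
| RMin k (f : recf k.+1) : recf k.

(** [reval c v y]: the partial function coded by [c] is defined at [v], with
    value [y].  The recursion variable of [RPrec] and the search variable of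
    [RMin] come first; as usual for partial functions, [RMin f] at [v] has
    value [n] only if [f] is defined and nonzero at all [(m, v)], [m < n]. *)
Inductive reval : forall k, recf k -> k.-tuple nat -> nat -> Prop :=
| EvalZero k (v : k.-tuple nat) : reval (RZero k) v 0%N
| EvalSucc (v : 1.-tuple nat) : reval RSucc v (thead v).+1
| EvalProj k (i : 'I_k) (v : k.-tuple nat) : reval (RProj i) v (tnth v i)
| EvalComp m k (f : recf m) (g : 'I_m -> recf k) (v : k.-tuple nat)
    (w : m.-tuple nat) (y : nat) :
    (forall i, reval (g i) v (tnth w i)) -> reval f w y ->
    reval (RComp f g) v y
| EvalPrec0 k (f : recf k) (g : recf k.+2) (v : k.-tuple nat) (y : nat) :
    reval f v y -> reval (RPrec f g) (cons_tuple 0%N v) y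
| EvalPrecS k (f : recf k) (g : recf k.+2) (v : k.-tuple nat) (n z y : nat) :
    reval (RPrec f g) (cons_tuple n v) z ->
    reval g (cons_tuple n (cons_tuple z v)) y ->
    reval (RPrec f g) (cons_tuple n.+1 v) y
| EvalMin k (f : recf k.+1) (v : k.-tuple nat) (n : nat) (z : nat -> nat) :
    (forall m, (m < n)%N -> reval f (cons_tuple m v) (z m).+1) ->
    reval f (cons_tuple n v) 0%N ->
    reval (RMin f) v n.

Definition total_recursive (f : nat -> nat) : Prop :=
  exists c : recf 1, forall n, reval c [tuple n] (f n).

(** Sequences [(q_n)_{n >= 1}] are encoded as functions on [nat] whose value
    at [0] is irrelevant. *)
Definition basic_sequence (q : nat -> nat) : Prop :=
  forall n, (1 <= n)%N -> (2 <= q n)%N.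

Section CantorSeries.
Variable R : realType.
Implicit Types (q E : nat -> nat) (x : R).

(** [qprod q i k] is [q_i q_(i+1) ... q_(i+k-1)]. *)
Definition qprod q (i k : nat) : R := \prod_(i <= l < i + k) (q l)%:R.

(** [E_0] is kept apart from the digits [E_n], [n >= 1], as it is a signed
    integer; [E 0] is irrelevant. *)
Definition cantor_expansion q x (E0 : int) E : Prop :=
  [/\ E0 = Num.floor x,
      (forall n, (1 <= n)%N -> (E n <= q n - 1)%N),
      (forall m, exists2 n, (m < n)%N & E n <> (q n - 1)%N)
    & (fun N : nat =>
         E0%:~R + \sum_(1 <= n < N.+1) (E n)%:R / qprod q 1 n) @ \oo --> x].

(** The base-b expansion is the Cantor series expansion for the constant
    basic sequence [b]. The integer part, a single integer, needs no
    computability condition. *)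
Definition computable_real x : Prop :=
  exists b : nat, (2 <= b)%N /\
  exists (E0 : int) (E : nat -> nat),
    cantor_expansion (fun=> b) x E0 E /\ total_recursive E.

Definition block_occ k (B : k.-tuple nat) E (n : nat) : nat :=
  count (fun i => [forall j : 'I_k, E (i + j)%N == tnth B j]) (iota 1 n).

Definition Qsum q (k n : nat) : R := \sum_(1 <= j < n.+1) (qprod q j k)^-1.

(** The expansion of [x] exists and is unique when [q] is basic. *)
Definition normal_numbers q : set R :=
  [set x | exists (E0 : int) (E : nat -> nat),
    cantor_expansion q x E0 E /\
    forall k (B : k.-tuple nat), (1 <= k)%N ->
      (fun n : nat => (block_occ B E n)%:R / Qsum q k n) @ \oo --> (1 : R)].

Definition fracp x : R := x - (Num.floor x)%:~R.

(** The sequence is indexed from [0]. *)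
Definition uniformly_distributed_mod1 (u : nat -> R) : Prop :=
  forall a b : R, 0 <= a -> a < b -> b <= 1 ->
    (fun N : nat =>
       (count (fun n => a <= fracp (u n) < b) (iota 0 N))%:R / N%:R : R)
      @ \oo --> b - a.

Definition distribution_normal_numbers q : set R :=
  [set x | uniformly_distributed_mod1 (fun n => qprod q 1 n * x)].

End CantorSeries.

(* Main.v *)
Require Import Defs.
From HB Require Import structures.
From mathcomp Require Import all_boot all_order all_algebra.
From mathcomp Require Import boolp classical_sets functions reals.
From mathcomp Require Import topology normedtype sequences.
From mathcomp Require Import zify ring lra.

(** Write [P_n = q_1 ... q_n] and let [T_n(x)] be the fractional part of
    [P_n x].  Most positions are fillers, with [q_n = (n+1)!] and digit [n!];
    between them stand rare words of length [g] in a slowly growing even base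
    [Q = 2g+2], which run periodically through all [V = Q^g] words.

    Let [y = rho x + sigma] with [rho <> 0] and [sigma] rational.  At a late
    filler, the common denominator of [rho] and [sigma] divides [P_n] and
    [P_n x - T_n(x)], so [T_n(y)] is the fractional part of [rho T_n(x)].  This
    has three consequences.
    - If the next position is a filler too, [T_n(x)] is small and [T_n(y)] is
      close to [0] or [1]; fillers have density one, so [y] is not distribution
      normal.
    - The digits of [y] at fillers tend to infinity and the weights [1/q_n] of
      fillers are summable, so fillers do not affect the frequencies of blocks.
    - Inside the word number [W], [T(y)] after [e] letters is the fractional
      part of [rho Q^e (W + theta) / V] with [0 <= theta < 1].  As [W] runs
      through [0, ..., V-1], it falls in an interval of length [Q^-k] with
      frequency [Q^-k], up to an error whose sum over [e] is [O(Q^-k)], which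
      is negligible because there are [g-k+1] choices of [e].

    As all [q_n] are even, [2^n] divides [P_n], and the first [n] bits of [x]
    can be read off the [n]-th partial sum of its Cantor series. *)

Set Implicit Arguments.
Unset Strict Implicit.
Unset Printing Implicit Defensive.

(** * Recursive functions *)

Definition recursive k (F : k.-tuple nat -> nat) : Prop :=
  exists c : recf k, forall v, reval c v (F v).

Lemma eq_recursive k (F G : k.-tuple nat -> nat) :
  F =1 G -> recursive F -> recursive G.
Proof. by move=> eqFG [c cF]; exists c => v; rewrite -eqFG. Qed.

Lemma recursive_proj k (i : 'I_k) : recursive (fun v => tnth v i).
Proof. by exists (RProj i) => v; exact: EvalProj. Qed.

Lemma recursive_comp m k (F : m.-tuple nat -> nat)
    (G : 'I_m -> k.-tuple nat -> nat) :
  recursive F -> (forall i, recursive (G i)) ->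
  recursive (fun v => F [tuple G i v | i < m]).
Proof.
move=> [c cF] /choice [d dG]; exists (RComp c d) => v.
apply: (@EvalComp _ _ _ _ _ [tuple G i v | i < m]) => // i.
by rewrite tnth_mktuple.
Qed.

(** Taking [u] as any function that obeys the recursion equations lets this apply directly to
    library functions such as [addn] or [factorial]. *)
Lemma recursive_prec k (F : k.-tuple nat -> nat) (G : k.+2.-tuple nat -> nat)
    (u : nat -> k.-tuple nat -> nat) :
  recursive F -> recursive G -> (forall v, u 0%N v = F v) ->
  (forall n v, u n.+1 v = G (cons_tuple n (cons_tuple (u n v) v))) ->
  recursive (fun v : k.+1.-tuple nat => u (thead v) (behead_tuple v)).
Proof.
move=> [c cF] [d dG] u0 uS; exists (RPrec c d) => v.
have [n [w ->]] : exists n w, v = cons_tuple n w.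
  by exists (thead v), (behead_tuple v); apply: val_inj; case: v => -[].
have -> : behead_tuple (cons_tuple n w) = w :> k.-tuple nat by exact: val_inj.
rewrite theadE; elim: n => [|n IHn]; first by rewrite u0; exact: EvalPrec0.
by rewrite uS; exact: EvalPrecS IHn _.
Qed.

Definition recursive2 (F : nat -> nat -> nat) : Prop :=
  recursive (fun v : 2.-tuple nat => F (tnth v ord0) (tnth v ord_max)).

Lemma total_recursiveP (f : nat -> nat) :
  total_recursive f <-> recursive (fun v : 1.-tuple nat => f (tnth v ord0)).
Proof.
split=> -[c cf]; exists c.
  by move=> v; rewrite [X in reval c X](_ : v = [tuple tnth v ord0]) //;
    apply/eq_from_tnth => i; rewrite (ord1 i).
by move=> n; have := cf [tuple n].
Qed.

Lemma eq_total_recursive (f g : nat -> nat) :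
  f =1 g -> total_recursive f -> total_recursive g.
Proof. by move=> eqfg [c cf]; exists c => n; rewrite -eqfg. Qed.

Lemma recursive_app1 (f : nat -> nat) k (F : k.-tuple nat -> nat) :
  total_recursive f -> recursive F -> recursive (fun v => f (F v)).
Proof.
move=> /total_recursiveP rf rF.
apply: eq_recursive (recursive_comp rf (fun=> rF)) => v.
by rewrite tnth_mktuple.
Qed.

Lemma recursive_app2 (f : nat -> nat -> nat) k (F G : k.-tuple nat -> nat) :
  recursive2 f -> recursive F -> recursive G ->
  recursive (fun v => f (F v) (G v)).
Proof.
move=> rf rF rG.
apply: eq_recursive
  (recursive_comp (G := fun i => if i == ord0 then F else G) rf _) => [v|i].
  by rewrite !tnth_mktuple.
by case: ifP.
Qed.

Lemma total_recursive_app2 (f : nat -> nat -> nat) (a b : nat -> nat) :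
  recursive2 f -> total_recursive a -> total_recursive b ->
  total_recursive (fun n => f (a n) (b n)).
Proof.
move=> rf /total_recursiveP ra /total_recursiveP rb; apply/total_recursiveP.
exact: (recursive_app2 rf ra rb).
Qed.

Lemma total_recursive_comp (f a : nat -> nat) :
  total_recursive f -> total_recursive a -> total_recursive (fun n => f (a n)).
Proof.
move=> rf /total_recursiveP ra; apply/total_recursiveP.
exact: (recursive_app1 rf ra).
Qed.

Lemma total_recursive_id : total_recursive id.
Proof. by apply/total_recursiveP; exact: recursive_proj. Qed.

Lemma total_recursive_succ : total_recursive succn.
Proof. by exists RSucc => n; exact: (EvalSucc [tuple n]). Qed.

Lemma recursive_const k (a : nat) : recursive (fun _ : k.-tuple nat => a).
Proof.
elim: a => [|a IHa]; first by exists (RZero k) => v; exact: EvalZero.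
exact: (recursive_app1 total_recursive_succ IHa).
Qed.

Lemma total_recursive_const (a : nat) : total_recursive (fun=> a).
Proof. by apply/total_recursiveP; exact: recursive_const. Qed.

Lemma total_recursive_prec (u : nat -> nat) (G : nat -> nat -> nat) :
  recursive2 G -> (forall n, u n.+1 = G n (u n)) -> total_recursive u.
Proof.
move=> rG uS; apply/total_recursiveP.
apply: (eq_recursive (F := fun v : 1.-tuple nat => u (thead v))).
  by move=> v; rewrite /thead.
apply: (recursive_prec (F := fun=> u 0) (u := fun n=> fun=> u n) _ rG) => //.
exact: recursive_const.
Qed.

Lemma recursive2_prec (u : nat -> nat -> nat) (f : nat -> nat)
    (G : nat -> nat -> nat -> nat) :
  total_recursive f ->
  recursive (fun v : 3.-tuple nat =>
    G (tnth v ord0) (tnth v (lift ord0 ord0)) (tnth v ord_max)) ->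
  (forall b, u 0 b = f b) -> (forall n b, u n.+1 b = G n (u n b) b) ->
  recursive2 u.
Proof.
move=> /total_recursiveP rf rG u0 uS.
have R := @recursive_prec 1 _ _ (fun n v => u n (tnth v ord0)) rf rG.
apply: eq_recursive (R _ _) => [v|v|n v].
- by rewrite /thead !(tnth_nth 0) /= nth_behead.
- exact: u0.
- by rewrite uS !(tnth_nth 0).
Qed.

Lemma recursive2_swap (f : nat -> nat -> nat) :
  recursive2 f -> recursive2 (fun a b => f b a).
Proof. by move=> rf; apply: (recursive_app2 rf); exact: recursive_proj. Qed.

Lemma recursive2_add : recursive2 addn.
Proof.
apply: (@recursive2_prec _ id (fun _ z _ => z.+1)) => //.
- exact: total_recursive_id.
- exact: (recursive_app1 total_recursive_succ (recursive_proj _)).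
Qed.

Lemma recursive2_mul : recursive2 muln.
Proof.
apply: (@recursive2_prec _ (fun=> 0) (fun _ z b => b + z)) => //.
- exact: total_recursive_const.
- by apply: (recursive_app2 recursive2_add); exact: recursive_proj.
Qed.

Lemma recursive2_exp : recursive2 expn.
Proof.
apply: (@recursive2_swap (fun b a => a ^ b)).
apply: (@recursive2_prec _ (fun=> 1) (fun _ z b => b * z)) => [|||n b].
- exact: total_recursive_const.
- by apply: (recursive_app2 recursive2_mul); exact: recursive_proj.
- by [].
- exact: expnS.
Qed.

Lemma total_recursive_pred : total_recursive predn.
Proof. exact: (@total_recursive_prec _ (fun n _ => n) (recursive_proj _)). Qed.

Lemma recursive2_sub : recursive2 subn.
Proof.
apply: (@recursive2_swap (fun b a => a - b)).
apply: (@recursive2_prec _ id (fun _ z _ => z.-1)) => [|||n b].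
- exact: total_recursive_id.
- exact: (recursive_app1 total_recursive_pred (recursive_proj _)).
- exact: subn0.
- exact: subnS.
Qed.

Lemma recursive2_leq : recursive2 (fun a b => (a <= b) : nat).
Proof.
apply: (@eq_recursive 2 (fun v => 1 - (tnth v ord0 - tnth v ord_max))).
  by move=> v; lia.
apply: (recursive_app2 recursive2_sub); first exact: recursive_const.
exact: recursive2_sub.
Qed.

Lemma recursive2_div : recursive2 divn.
Proof.
(* The quotient grows by one exactly when the next multiple [z.+1 * b] is reached. The factor
   [0 < b] keeps the default value [0] of division by [0]. *)
apply: (@recursive2_prec _ (fun=> 0)
  (fun n z b => z + (z.+1 * b <= n.+1) * (0 < b))) => [|||n b].
- exact: total_recursive_const.
- apply: (recursive_app2 recursive2_add); first exact: recursive_proj.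
  apply: (recursive_app2 recursive2_mul).
    apply: (recursive_app2 recursive2_leq); last first.
      exact: (recursive_app1 total_recursive_succ (recursive_proj _)).
    apply: (recursive_app2 recursive2_mul); last exact: recursive_proj.
    exact: (recursive_app1 total_recursive_succ (recursive_proj _)).
  apply: (recursive_app2 recursive2_leq); last exact: recursive_proj.
  exact: recursive_const.
- by move=> b; rewrite div0n.
- case: b => [|b]; first by rewrite !divn0 muln0.
  rewrite muln1; have := divn_eq n b.+1; have := ltn_pmod n (ltn0Sn b).
  set d := n %/ b.+1; set m := n %% b.+1 => + ->.
  rewrite -addnS mulSn [b.+1 + _]addnC leq_add2l divnMDl //.
  rewrite ltnS leq_eqVlt => /predU1P[->|hm]; first by rewrite divnn leqnn.
  by rewrite divn_small; lia.
Qed.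

Lemma recursive2_mod : recursive2 modn.
Proof.
apply: (@eq_recursive 2 (fun v => tnth v ord0 -
  tnth v ord0 %/ tnth v ord_max * tnth v ord_max)).
  by move=> v; rewrite {1}(divn_eq (tnth v ord0) (tnth v ord_max)) addKn.
apply: (recursive_app2 recursive2_sub); first exact: recursive_proj.
by apply: (recursive_app2 recursive2_mul) recursive2_div _; exact: recursive_proj.
Qed.

Lemma total_recursive_fact : total_recursive factorial.
Proof.
apply: (@total_recursive_prec _ (fun n z => n.+1 * z)) => //.
apply: (recursive_app2 recursive2_mul); last exact: recursive_proj.
exact: (recursive_app1 total_recursive_succ (recursive_proj _)).
Qed.

Lemma total_recursive_if (p : nat -> bool) (a b : nat -> nat) :
  total_recursive (fun n => p n : nat) -> total_recursive a ->
  total_recursive b -> total_recursive (fun n => if p n then a n else b n).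
Proof.
move=> rp ra rb.
have [c cE] : total_recursive (fun n => p n * a n + (1 - p n) * b n).
  apply: (total_recursive_app2 recursive2_add).
    exact: (total_recursive_app2 recursive2_mul).
  apply: (total_recursive_app2 recursive2_mul) => //.
  by apply: (total_recursive_app2 recursive2_sub) => //; exact: total_recursive_const.
exists c => n; have := cE n; case: (p n) => /=; first by rewrite mul1n mul0n addn0.
by rewrite mul0n mul1n.
Qed.

(** The inverse of an increasing function [h] with [h 0 = 0], rounded down. *)
Fixpoint inverse (h : nat -> nat) (n : nat) : nat :=
  if n is m.+1 then inverse h m + (h (inverse h m).+1 <= m.+1) else 0.

Lemma total_recursive_inverse (h : nat -> nat) :
  total_recursive h -> total_recursive (inverse h).
Proof.
move=> rh; apply: (@total_recursive_prec _ (fun n z => z + (h z.+1 <= n.+1))) => //.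
apply: (recursive_app2 recursive2_add); first exact: recursive_proj.
apply: (recursive_app2 recursive2_leq).
  apply: (recursive_app1 rh).
  exact: (recursive_app1 total_recursive_succ (recursive_proj _)).
exact: (recursive_app1 total_recursive_succ (recursive_proj _)).
Qed.

Section Inverse.
Variable h : nat -> nat.
Hypotheses (h0 : h 0 = 0) (hS : forall n, h n < h n.+1).

(** Raising the value by at most one per step is enough, since a strictly increasing [h] cannot pass
    two of its values in one step. *)
Lemma inverse_bounds n : h (inverse h n) <= n < h (inverse h n).+1.
Proof.
elim: n => [|n /andP[IH1 IH2]] /=; first by rewrite h0 -[X in X < _]h0 hS.
case: (leqP (h (inverse h n).+1) n.+1) => hn /=.
  by rewrite addn1 hn (leq_ltn_trans IH2 (hS _)).
by rewrite addn0 hn (leq_trans IH1).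
Qed.

Lemma inverse_homo m n : m <= n -> inverse h m <= inverse h n.
Proof.
move=> /subnK <-; elim: (n - m) => // k IHk.
by rewrite addSn /= (leq_trans IHk) ?leq_addr.
Qed.

Lemma leq_inverse m n : (m <= inverse h n) = (h m <= n).
Proof.
have mono : {mono h : a b / a <= b} by apply/leq_mono/(homo_ltn ltn_trans).
have /andP[h1 h2] := inverse_bounds n.
apply/idP/idP => hm; first by rewrite (leq_trans _ h1) // mono.
by rewrite -ltnS -(leqW_mono mono) (leq_ltn_trans hm).
Qed.
End Inverse.

(** * The basic sequence and the digits *)

Definition sqrtn : nat -> nat := inverse (fun n => n * n).
(** With [V = (2g+2)^g] words of length [g], the condition is [g * V <= n]. The factor [g] ensures
    that the [2i+1] blocks of pass [i] run through all words at least [g] times. *)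
Definition level : nat -> nat := inverse (fun g => g * g.*2.+2 ^ g).

(** Position [n = s^2 + o], [o <= 2s], lies in block [s = blk n] at offset
    [o = off n]; block [s = i^2 + t], [t <= 2i], lies in pass [i].  Each block is
    a word of length [lev n] followed by fillers, and the word is [t] modulo the
    number of words, written in base [base n]. *)
Definition blk n := sqrtn n.
Definition off n := n - blk n * blk n.
Definition pass n := sqrtn (blk n).
Definition lev n := level (pass n).
Definition base n := (lev n).*2.+2.
Definition word n := (blk n - pass n * pass n) %% base n ^ lev n.

(** The base [2g+2] keeps every base even for [n > 0], and factorials are eventually multiples of
    any fixed denominator. *)
Definition bases n := if off n < lev n then base n else n.+1`!.
Definition digits n :=
  if off n < lev n then word n %/ base n ^ (lev n - (off n).+1) %% base n
  else n`!.

(** [numer q E n / denom q n] is the [n]-th partial sum of the Cantor series; both terms stay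
    natural numbers, so both are computable. *)
Fixpoint denom (q : nat -> nat) n :=
  if n is m.+1 then q m.+1 * denom q m else 1.
Fixpoint numer (q E : nat -> nat) n :=
  if n is m.+1 then q m.+1 * numer q E m + E m.+1 else 0.

(** Only the [n]-th partial sum enters. For even bases, [floor_pow2_cantor_value] shows that the
    full series has the same integer part after multiplication by [2^n]. *)
Definition bit (q E : nat -> nat) n := (2 ^ n * numer q E n) %/ denom q n %% 2.

(** * Computability of the bases, the digits and the binary digits *)

Lemma total_recursive_sqrtn : total_recursive sqrtn.
Proof.
apply: total_recursive_inverse.
exact: (total_recursive_app2 recursive2_mul total_recursive_id total_recursive_id).
Qed.

Lemma total_recursive_double2 a :
  total_recursive a -> total_recursive (fun n => (a n).*2.+2).
Proof.
move=> ra; apply: (@eq_total_recursive (fun n => (2 * a n + 2)%N)).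
  by move=> n; rewrite addn2 mul2n.
apply: (total_recursive_app2 recursive2_add); last exact: total_recursive_const.
by apply: (total_recursive_app2 recursive2_mul) => //; exact: total_recursive_const.
Qed.

Lemma total_recursive_level : total_recursive level.
Proof.
apply: total_recursive_inverse.
apply: (total_recursive_app2 recursive2_mul); first exact: total_recursive_id.
apply: (total_recursive_app2 recursive2_exp); last exact: total_recursive_id.
exact: (total_recursive_double2 total_recursive_id).
Qed.

Lemma total_recursive_sub_sqr a b :
  total_recursive a -> total_recursive b ->
  total_recursive (fun n => a n - b n * b n).
Proof.
move=> ra rb; apply: (total_recursive_app2 recursive2_sub) => //.
exact: (total_recursive_app2 recursive2_mul).
Qed.

Lemma total_recursive_off : total_recursive off.
Proof.
exact: (total_recursive_sub_sqr total_recursive_id total_recursive_sqrtn).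
Qed.

Lemma total_recursive_pass : total_recursive pass.
Proof. exact: (total_recursive_comp total_recursive_sqrtn total_recursive_sqrtn). Qed.

Lemma total_recursive_lev : total_recursive lev.
Proof. exact: (total_recursive_comp total_recursive_level total_recursive_pass). Qed.

Lemma total_recursive_base : total_recursive base.
Proof. exact: (total_recursive_double2 total_recursive_lev). Qed.

Lemma total_recursive_word : total_recursive word.
Proof.
apply: (total_recursive_app2 recursive2_mod).
  exact: (total_recursive_sub_sqr total_recursive_sqrtn total_recursive_pass).
exact: (total_recursive_app2 recursive2_exp total_recursive_base total_recursive_lev).
Qed.

Lemma total_recursive_off_lt_lev : total_recursive (fun n => (off n < lev n) : nat).
Proof.
apply: (total_recursive_app2 recursive2_leq _ total_recursive_lev).
exact: (total_recursive_comp total_recursive_succ total_recursive_off).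
Qed.

Lemma total_recursive_bases : total_recursive bases.
Proof.
apply: (total_recursive_if total_recursive_off_lt_lev total_recursive_base).
exact: (total_recursive_comp total_recursive_fact total_recursive_succ).
Qed.

Lemma total_recursive_digits : total_recursive digits.
Proof.
apply: (total_recursive_if total_recursive_off_lt_lev) total_recursive_fact.
apply: (total_recursive_app2 recursive2_mod) total_recursive_base.
apply: (total_recursive_app2 recursive2_div) total_recursive_word _.
apply: (total_recursive_app2 recursive2_exp) total_recursive_base _.
apply: (total_recursive_app2 recursive2_sub) total_recursive_lev _.
exact: (total_recursive_comp total_recursive_succ total_recursive_off).
Qed.

Lemma total_recursive_denom q : total_recursive q -> total_recursive (denom q).
Proof.
move=> rq; apply: (@total_recursive_prec _ (fun n z => q n.+1 * z)) => //.
apply: (recursive_app2 recursive2_mul); last exact: recursive_proj.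
apply: (recursive_app1 rq).
exact: (recursive_app1 total_recursive_succ (recursive_proj _)).
Qed.

Lemma total_recursive_numer q E :
  total_recursive q -> total_recursive E -> total_recursive (numer q E).
Proof.
move=> rq rE; apply: (@total_recursive_prec _ (fun n z => q n.+1 * z + E n.+1)) => //.
have rS := recursive_app1 total_recursive_succ (recursive_proj (@ord0 1)).
apply: (recursive_app2 recursive2_add); last exact: (recursive_app1 rE rS).
apply: (recursive_app2 recursive2_mul); last exact: recursive_proj.
exact: (recursive_app1 rq rS).
Qed.

Lemma total_recursive_bit q E :
  total_recursive q -> total_recursive E -> total_recursive (bit q E).
Proof.
move=> rq rE.
apply: (total_recursive_app2 recursive2_mod) (total_recursive_const 2).
apply: (total_recursive_app2 recursive2_div) (total_recursive_denom rq).
apply: (total_recursive_app2 recursive2_mul) (total_recursive_numer rq rE).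
exact: (total_recursive_app2 recursive2_exp
  (total_recursive_const 2) total_recursive_id).
Qed.

(** * Arithmetic of [sqrtn] and [level], and first properties of the bases and digits *)

Lemma sqrtn_bounds n : sqrtn n * sqrtn n <= n < (sqrtn n).+1 * (sqrtn n).+1.
Proof. by apply: (@inverse_bounds (fun n => n * n)) => // m; rewrite ltn_mul. Qed.

Lemma leq_sqrtn m n : (m <= sqrtn n) = (m * m <= n).
Proof. by apply: (@leq_inverse (fun n => n * n)) => // k; rewrite ltn_mul. Qed.

Lemma sqrtn_eq m n : m * m <= n -> n < m.+1 * m.+1 -> sqrtn n = m.
Proof.
move=> h1 h2; apply/eqP; rewrite eqn_leq [X in _ && X]leq_sqrtn h1 andbT.
by rewrite -ltnS ltnNge leq_sqrtn -ltnNge.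
Qed.

Lemma level_fun_lt g : g * g.*2.+2 ^ g < g.+1 * (g.+1).*2.+2 ^ g.+1.
Proof.
apply: (@leq_trans (g.+1 * g.*2.+2 ^ g)); first by rewrite ltn_pmul2r ?expn_gt0.
rewrite leq_pmul2l //; apply: (@leq_trans ((g.+1).*2.+2 ^ g)).
  by case: g => // g; rewrite leq_exp2r //; lia.
by rewrite leq_pexp2l.
Qed.

Lemma leq_level m n : (m <= level n) = (m * m.*2.+2 ^ m <= n).
Proof. exact: (@leq_inverse (fun g => g * g.*2.+2 ^ g) _ level_fun_lt). Qed.

Lemma level_bound i : level i * (level i).*2.+2 ^ level i <= i.
Proof. by rewrite -leq_level. Qed.

Lemma level_homo m n : m <= n -> level m <= level n.
Proof. exact: inverse_homo. Qed.

Lemma level_le i : level i <= i.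
Proof. by apply: leq_trans (level_bound i); rewrite leq_pmulr ?expn_gt0. Qed.

Lemma blk_off s o : o <= s.*2 ->
  (blk (s * s + o) = s) * (off (s * s + o) = o).
Proof.
move=> ho; have e : blk (s * s + o) = s by apply: sqrtn_eq; lia.
by split=> //; rewrite /off e addKn.
Qed.

Lemma bases_ge2 n : 0 < n -> 2 <= bases n.
Proof.
case: n => // n _; rewrite /bases; case: ifP => // _.
by apply: (@leq_trans n.+2); rewrite // fact_geq.
Qed.

Lemma bases_even n : 0 < n -> 2 %| bases n.
Proof.
case: n => // n _; rewrite /bases; case: ifP => _; last by rewrite dvdn_fact.
by rewrite dvdn2 /base; lia.
Qed.

Lemma digits_lt n : 0 < n -> digits n < bases n.
Proof.
case: n => // n _; rewrite /digits /bases; case: ifP => _; first by rewrite ltn_mod.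
by rewrite [X in _ < X]factS -[X in X < _]mul1n ltn_pmul2r ?fact_gt0.
Qed.

Import Order.TTheory GRing.Theory Num.Theory.
Import numFieldNormedType.Exports.
Local Open Scope classical_set_scope.
Local Open Scope ring_scope.

(** * Cantor series expansions *)

Section Limits.
Variable R : realType.
Implicit Types (u : nat -> R) (x y : R).

Lemma cvg_seqP u l :
  u @ \oo --> l <->
  forall e, 0 < e -> exists N, forall n, (N <= n)%N -> `|u n - l| <= e.
Proof.
split=> [/cvgrPdistC_le ul e e0|ul].
  by have [N _ hN] := ul e e0; exists N => n Nn; exact: hN.
apply/cvgrPdistC_le => e e0; have [N hN] := ul e e0.
by exists N => // n Nn; exact: hN.
Qed.

Lemma nat_gt x : exists n, x < n%:R.
Proof. by exists (Num.truncn x).+1; exact: truncnS_gt. Qed.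

Lemma ltr_pow2 n : n%:R < 2 ^+ n :> R.
Proof. by rewrite -natrX ltr_nat ltn_expl. Qed.

Lemma pow2_small e : 0 < e -> exists N, forall n, (N <= n)%N -> (2 ^+ n)^-1 <= e :> R.
Proof.
move=> e0; have [N hN] := nat_gt e^-1; exists N => n Nn.
rewrite -[leRHS]invrK lef_pV2 ?posrE ?invr_gt0 ?exprn_gt0 //.
by apply/ltW/(lt_le_trans hN)/(@le_trans _ _ n%:R); rewrite ?ler_nat // ltW ?ltr_pow2.
Qed.
End Limits.

(** * Existence of the Cantor series expansion *)

Section Cantor.
Variable R : realType.
Implicit Types (x y : R).

Lemma fracp_itv x : 0 <= fracp x < 1.
Proof.
by have := floor_itv x; rewrite /fracp intrD subr_ge0 ltrBlDl => /andP[-> ->].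
Qed.

Lemma fracp_def x (z : int) t : x = z%:~R + t -> 0 <= t < 1 -> fracp x = t.
Proof.
move=> -> ht; rewrite /fracp (@floor_def _ _ z); first by rewrite addrC addKr.
by rewrite intrD lerDl ltrD2l.
Qed.

Lemma fracpD_int x (z : int) : fracp (x + z%:~R) = fracp x.
Proof.
apply: (@fracp_def _ (Num.floor x + z)); last exact: fracp_itv.
by rewrite intrD /fracp; ring.
Qed.

Lemma fracpD_fracp x y : fracp (x + fracp y) = fracp (x + y).
Proof.
rewrite -[RHS](fracpD_int _ (- Num.floor y)); congr fracp.
by rewrite /fracp intrN addrA.
Qed.

Lemma fracpM_nat n x : fracp (n%:R * fracp x) = fracp (n%:R * x).
Proof.
rewrite -[RHS](fracpD_int _ (- (n%:Z * Num.floor x))); congr fracp.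
by rewrite /fracp intrN intrM mulrBr.
Qed.

Lemma fracp_small x : 0 <= x < 1 -> fracp x = x.
Proof. by move=> hx; apply: (@fracp_def _ 0) hx; rewrite add0r. Qed.

Definition cantor_digit (q : nat -> nat) y n : nat :=
  Num.truncn ((q n)%:R * fracp (qprod R q 1 n.-1 * y)).

Variable q : nat -> nat.
Hypothesis q_ge2 : basic_sequence q.

Lemma qprod0 i : qprod R q i 0 = 1.
Proof. by rewrite /qprod addn0 big_geq. Qed.

Lemma qprodS i n : qprod R q i n.+1 = qprod R q i n * (q (i + n)%N)%:R.
Proof. by rewrite /qprod addnS big_nat_recr //= leq_addr. Qed.

Lemma qprod_denom n : qprod R q 1 n = (denom q n)%:R.
Proof.
by elim: n => [|n IHn]; rewrite ?qprod0 // qprodS IHn mulrC natrM add1n.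
Qed.

Lemma qprod_ge n : 2 ^+ n <= qprod R q 1 n.
Proof.
elim: n => [|n IHn]; first by rewrite qprod0.
rewrite qprodS exprSr; apply: ler_pM; rewrite ?exprn_ge0 //.
by rewrite (ler_nat R 2) q_ge2.
Qed.

Lemma qprod_gt0 n : 0 < qprod R q 1 n.
Proof. exact: lt_le_trans (exprn_gt0 _ _) (qprod_ge n). Qed.

(** The shift of the Cantor series: multiplying [T_n] by the next base splits off a digit and leaves
    [T_(n+1)], because [P_n y] and its fractional part differ by an integer. *)
Lemma cantor_digit_fracp y n :
  (q n.+1)%:R * fracp (qprod R q 1 n * y) =
  (cantor_digit q y n.+1)%:R + fracp (qprod R q 1 n.+1 * y).
Proof.
have := fracp_itv (qprod R q 1 n * y); rewrite /cantor_digit /=.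
set t := fracp _ => /andP[t0 t1].
have qt0 : 0 <= (q n.+1)%:R * t by rewrite mulr_ge0.
have /andP[h1 h2] := truncn_itv qt0; set d := Num.truncn _ in h1 h2 *.
rewrite (_ : fracp _ = (q n.+1)%:R * t - d%:R); first by ring.
rewrite qprodS add1n [_ * (q _)%:R]mulrC -mulrA -fracpM_nat -/t.
by apply: (@fracp_def _ d%:Z); rewrite ?pmulrn; [ring|move: h2; rewrite -natr1; lra].
Qed.

Lemma cantor_digit_le y n : (1 <= n)%N -> (cantor_digit q y n <= q n - 1)%N.
Proof.
move=> n1; have := q_ge2 n1; have := fracp_itv (qprod R q 1 n.-1 * y).
rewrite /cantor_digit; set t := fracp _ => /andP[t0 t1] q2.
rewrite -ltnS subn1 prednK ?truncn_lt_nat ?mulr_ge0 //; last by lia.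
by rewrite gtr_pMr // ltr0n; lia.
Qed.

Lemma cantor_digit_sum y n :
  \sum_(1 <= i < n.+1) (cantor_digit q y i)%:R / qprod R q 1 i =
  y - (Num.floor y)%:~R - fracp (qprod R q 1 n * y) / qprod R q 1 n.
Proof.
elim: n => [|n IHn].
  by rewrite big_geq // qprod0 mul1r divr1 /fracp subrr.
rewrite big_nat_recr //= IHn.
have := cantor_digit_fracp y n; have := qprod_gt0 n; have := qprod_gt0 n.+1.
rewrite qprodS add1n; set P := qprod R q 1 n; set Q := (q n.+1)%:R => PQ P0 e.
have -> : (cantor_digit q y n.+1)%:R = Q * fracp (P * y) - fracp (P * Q * y).
  by rewrite e; ring.
have Q0 : Q != 0 by apply: contraTneq PQ => ->; rewrite mulr0 ltxx.
by field; rewrite Q0 gt_eqF.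
Qed.

Lemma cantor_expansionP y : cantor_expansion q y (Num.floor y) (cantor_digit q y).
Proof.
split=> //; first exact: cantor_digit_le.
  move=> m; apply: contrapT => hm.
  have hq n : (m < n)%N -> cantor_digit q y n = (q n - 1)%N.
    by move=> mn; apply: contrapT => hn; apply: hm; exists n.
  (* If all digits after [m] were maximal, the distance [t] of the orbit from [1] would at least
     double at each step, while it is positive and at most [1]. *)
  pose t n := 1 - fracp (qprod R q 1 n * y).
  have t1 n : 0 < t n <= 1.
    by have := fracp_itv (qprod R q 1 n * y); rewrite /t; lra.
  have ht k : 2 ^+ k * t m <= t (m + k)%N.
    elim: k => [|k IHk]; first by rewrite expr0 mul1r addn0.
    have := cantor_digit_fracp y (m + k); rewrite hq ?ltnS ?leq_addr //.
    have q2 := @q_ge2 (m + k).+1 isT.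
    rewrite natrB ?(leq_trans _ q2) // addnS exprS => e.
    have {e} e : (q (m + k).+1)%:R * t (m + k)%N = t (m + k).+1 by rewrite /t; lra.
    rewrite -e -mulrA; apply: ler_pM => //; rewrite ?ler_nat //.
    by rewrite mulr_ge0 // ?exprn_ge0 // ltW //; have /andP[] := t1 m.
  have /andP[tm0 _] := t1 m.
  have [N /(_ N (leqnn _))] := pow2_small (divr_gt0 tm0 (ltr0n R 2)).
  have /andP[_] := t1 (m + N)%N; have := ht N.
  have : 0 < 2 ^+ N :> R by rewrite exprn_gt0.
  set a := 2 ^+ N => a0 h1 h2 h3.
  have : a * a^-1 <= a * (t m / 2) by rewrite ler_pM2l.
  rewrite divff ?gt_eqF //; move: (t (m + N)%N) h1 h2 => b; lra.
(* By [cantor_digit_sum] the remainder is [T_n / P_n], which is at most [2^-n]. *)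
apply/cvg_seqP => e e0; have [N hN] := pow2_small e0; exists N => n Nn.
rewrite cantor_digit_sum.
rewrite (_ : _ - y = - (fracp (qprod R q 1 n * y) / qprod R q 1 n)); last by ring.
have /andP[f0 f1] := fracp_itv (qprod R q 1 n * y).
rewrite normrN ger0_norm ?divr_ge0 ?(ltW (qprod_gt0 n)) //.
apply: le_trans (hN _ Nn); apply: (@le_trans _ _ (1 / qprod R q 1 n)).
  by rewrite ler_pM2r ?invr_gt0 ?qprod_gt0 // ltW.
by rewrite div1r lef_pV2 ?posrE ?qprod_ge ?qprod_gt0 // exprn_gt0.
Qed.

End Cantor.

(** * The number with prescribed digits, and its binary expansion *)

Section CantorValue.
Variables (R : realType) (q E : nat -> nat).
Hypothesis q_ge2 : basic_sequence q.
Hypothesis E_lt : forall n, (0 < n)%N -> (E n < q n)%N.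
Hypothesis E_lt_pred : forall m, exists2 n, (m < n)%N & ((E n).+1 < q n)%N.

Definition cantor_value : R :=
  sup (range (fun n => (numer q E n)%:R / (denom q n)%:R)).

(** This is [T_n(x)]: [numer q E n] is an integer, and [tail_itv] places the difference in
    [[0, 1)]. *)
Definition tail n : R := (denom q n)%:R * cantor_value - (numer q E n)%:R.

Lemma denom_gt0 n : (0 < denom q n)%N.
Proof. by elim: n => //= n IHn; rewrite muln_gt0 IHn (ltn_trans _ (@q_ge2 n.+1 _)). Qed.

Lemma tailS n : (q n.+1)%:R * tail n = (E n.+1)%:R + tail n.+1.
Proof. by rewrite /tail /= natrD !natrM; ring. Qed.

(** Nested intervals, cleared of denominators: with [S_n] the partial sums and [P_n] the
    denominators, [S_n] increases while [S_n + 1/P_n] decreases, because digits are at most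
    [q_n - 1]. *)
Lemma numer_shift m k :
  (numer q E m * denom q (m + k) <= numer q E (m + k) * denom q m)%N /\
  (numer q E (m + k) * denom q m + denom q m <=
   (numer q E m).+1 * denom q (m + k))%N.
Proof.
elim: k => [|k [IH1 IH2]]; first by rewrite addn0; split; lia.
rewrite addnS /=; have := @E_lt (m + k).+1 isT.
move: (q (m + k).+1) (E (m + k).+1) => a b ab; split.
  by rewrite mulnCA mulnDl -mulnA (leq_trans _ (leq_addr _ _)) // leq_mul2l IH1 orbT.
rewrite mulnCA; apply: (@leq_trans (a * (numer q E (m + k) * denom q m + denom q m))).
  by rewrite mulnDl -mulnA mulnDr -addnA leq_add2l -mulSnr leq_mul2r ab orbT.
by rewrite leq_mul2l IH2 orbT.
Qed.

Lemma partial_sum_le m n :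
  (numer q E m)%:R / (denom q m)%:R <= ((numer q E n).+1)%:R / (denom q n)%:R :> R.
Proof.
rewrite ler_pdivrMr ?ltr0n ?denom_gt0 // mulrAC ler_pdivlMr ?ltr0n ?denom_gt0 //.
rewrite -!natrM ler_nat; case: (leqP m n) => [/subnKC <-|/ltnW/subnKC <-].
  have [h _] := numer_shift m (n - m); apply: leq_trans h _.
  by rewrite leq_mul2r leqnSn orbT.
by have [_ h] := numer_shift n (m - n); apply: leq_trans h; rewrite leq_addr.
Qed.

Lemma tail_itv01 n : 0 <= tail n <= 1.
Proof.
have hub : ubound (range (fun n => (numer q E n)%:R / (denom q n)%:R : R))
    (((numer q E n).+1)%:R / (denom q n)%:R).
  by move=> _ [m _ <-]; exact: partial_sum_le.
have hs : has_sup (range (fun n => (numer q E n)%:R / (denom q n)%:R : R)).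
  split; first by exists ((numer q E n)%:R / (denom q n)%:R), n.
  by exists (((numer q E n).+1)%:R / (denom q n)%:R).
have h1 : (numer q E n)%:R / (denom q n)%:R <= cantor_value.
  by apply: sup_upper_bound => //; exists n.
have h2 : cantor_value <= ((numer q E n).+1)%:R / (denom q n)%:R.
  by apply: ge_sup => //; case: hs.
move: h1 h2; rewrite ler_pdivrMr ?ler_pdivlMr ?ltr0n ?denom_gt0 // -natr1.
by rewrite /tail; lra.
Qed.

Lemma tail_itv n : 0 <= tail n < 1.
Proof.
have /andP[-> _] := tail_itv01 n; rewrite /=.
have back m : (E m.+1).+1%:R - 1 + tail m.+1 < (q m.+1)%:R -> tail m < 1.
  move=> h; have := tailS m; have := @q_ge2 m.+1 isT => q2.
  have q0 : 0 < (q m.+1)%:R :> R by rewrite ltr0n (ltn_trans _ q2).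
  rewrite -(ltr_pM2l q0) mulr1 => ->; move: h; rewrite -natr1; lra.
(* Strictness holds just before a digit that is not maximal, where the closed bound on the next tail
   suffices; [back] then carries it down to [n]. *)
have [m nm hm] := E_lt_pred n; case: m nm hm => // m; rewrite ltnS => nm hm.
have : tail m < 1.
  apply: back; move: hm; rewrite -(ltr_nat R); have := tail_itv01 m.+1; lra.
rewrite -(subnKC nm); elim: (m - n)%N => [|k IHk]; first by rewrite addn0.
rewrite addnS => hk; apply/IHk/back.
by have := @E_lt (n + k).+1 isT; rewrite -(ler_nat R); lra.
Qed.

Lemma cantor_value_itv : 0 <= cantor_value < 1.
Proof. by have := tail_itv 0; rewrite /tail /= mul1r subr0. Qed.

(** With [c = P_n / 2^n] an integer, [2^n x] is [(numer + tail) / c]. A tail in [[0, 1)] cannot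
    carry an integer numerator past the next multiple of [c]. *)
Lemma floor_pow2_cantor_value n : (forall m, (0 < m)%N -> (2 %| q m)%N) ->
  exists2 t, 0 <= t < 1 &
    2 ^+ n * cantor_value = (2 ^ n * numer q E n %/ denom q n)%:R + t.
Proof.
move=> q2; have /dvdnP[c ec] : (2 ^ n %| denom q n)%N.
  by elim: n => //= n IHn; rewrite expnS dvdn_mul ?q2.
have c0 : (0 < c)%N by have := denom_gt0 n; rewrite ec muln_gt0 => /andP[].
rewrite [X in (_ %/ X)%N]ec [(c * _)%N]mulnC divnMl ?expn_gt0 //.
have := divn_eq (numer q E n) c; have := ltn_pmod (numer q E n) c0.
set d := (_ %/ _)%N; set r := (_ %% _)%N => rc en.
have c0R : 0 < c%:R :> R by rewrite ltr0n.
exists ((r%:R + tail n) / c%:R).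
  have /andP[t0 t1] := tail_itv n.
  apply/andP; split; first by apply: divr_ge0 (ltW c0R); apply: addr_ge0.
  rewrite ltr_pdivrMr // mul1r.
  by move: rc; rewrite -(ler_nat R) -natr1; lra.
have : (denom q n)%:R * cantor_value = (numer q E n)%:R + tail n.
  by rewrite /tail addrC subrK.
rewrite ec {1}en natrM natrD natrM natrX => e.
apply: (mulfI (lt0r_neq0 c0R)); rewrite mulrA e; field.
exact: lt0r_neq0.
Qed.

Lemma computable_cantor_value :
  (forall m, (0 < m)%N -> (2 %| q m)%N) ->
  total_recursive q -> total_recursive E -> computable_real cantor_value.
Proof.
move=> q2 rq rE; exists 2%N; split=> //.
exists (Num.floor cantor_value), (bit q E); split; last exact: total_recursive_bit.
have b2 : basic_sequence (fun=> 2%N) by [].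
have P2 n : qprod R (fun=> 2%N) 1 n = 2 ^+ n.
  by elim: n => [|n IHn]; rewrite ?qprod0 // qprodS IHn exprSr.
have eqd n : (0 < n)%N -> cantor_digit (fun=> 2%N) cantor_value n = bit q E n.
  case: n => // n _; have := cantor_digit_fracp (fun=> 2%N) cantor_value n.
  have := @cantor_digit_le R _ b2 cantor_value n.+1 isT.
  have [t ht et] := floor_pow2_cantor_value n q2.
  have [t' ht' et'] := floor_pow2_cantor_value n.+1 q2.
  rewrite !P2 (fracp_def (z := Posz _) et ht) (fracp_def (z := Posz _) et' ht') /bit.
  move: et et'; rewrite exprS -mulrA => ->.
  set a := (_ %/ _)%N; set b := (_ %/ _)%N; set d := cantor_digit _ _ _ => e hd e'.
  (* The integer parts [a] of [2^n x] and [b] of [2^(n+1) x] are linked by the next binary digit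
     [d <= 1], which is therefore the parity of [b]. *)
  suff -> : b = (a * 2 + d)%N by rewrite modnMDl modn_small.
  by apply/eqP; rewrite -(eqr_nat R) natrD natrM; apply/eqP; lra.
have [h1 h2 h3 h4] := cantor_expansionP b2 cantor_value.
split=> //.
- by move=> n n0; rewrite -eqd ?h2.
- by move=> m; have [n mn hn] := h3 m; exists n => //; rewrite -eqd // (leq_trans _ mn).
- move/cvg_seqP: h4 => h4; apply/cvg_seqP => e e0; have [N hN] := h4 e e0.
  exists N => n Nn; rewrite (eq_big_nat _ _ (F2 := fun i =>
    (cantor_digit (fun=> 2%N) cantor_value i)%:R / qprod R (fun=> 2%N) 1 i)) ?hN //.
  by move=> i /andP[i0 _]; rewrite eqd.
Qed.
End CantorValue.

(** * Linear sequences modulo one *)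

Section LinearCount.
Variable R : realType.
Implicit Types (th : nat -> R) (u c lam al be de : R) (V : nat).

Let clamp V u : R := if u <= 0 then 0 else if u <= V%:R then u else V%:R.

(** [clamp V u] is the length of the part of [[0, V]] below [u]. Since [W + th W] lies in
    [[W, W+1]], the perturbation can only affect the unit interval around [u]. *)
Lemma count_below th V u : (forall W, 0 <= th W <= 1) ->
  `|\sum_(0 <= W < V) (W%:R + th W < u)%R%:R - clamp V u| <= 1.
Proof.
move=> th01; elim: V => [|V IHV].
  by rewrite big_geq // /clamp mulr0n; case: (lerP u 0); rewrite subrr normr0.
rewrite big_nat_recr //=; have V0 : 0 <= V%:R :> R by [].
move: IHV; rewrite /clamp -natr1; have /andP[t0 t1] := th01 V.
case: (lerP u 0) => u0.
  by rewrite (_ : (_ < _) = false) ?addr0 //; apply/negbTE; rewrite -leNgt; lra.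
case: (lerP u V%:R) => uV IHV.
  rewrite (_ : u <= V%:R + 1); last by lra.
  by rewrite (_ : (_ < _) = false) ?addr0 //; apply/negbTE; rewrite -leNgt; lra.
have -> : \sum_(0 <= W < V) (W%:R + th W < u)%R%:R = V%:R :> R.
  rewrite (eq_big_nat _ _ (F2 := fun=> 1)).
    by rewrite big_const_nat subn0 iter_addr_0.
  move=> W /andP[_ WV]; rewrite (_ : _ < u) //.
  have := th01 W; move: WV; rewrite -(ler_nat R) -natr1; lra.
have : 0 <= ((V%:R + th V < u)%R%:R : R) <= 1 by case: (_ < _); rewrite /=; lra.
set b := (_ < _)%R%:R => hb; rewrite ler_norml.
case: (lerP u (V%:R + 1)) => h; lra.
Qed.

Lemma clamp_diff V u w : 0 <= w ->
  0 <= clamp V (u + w) - clamp V u <= w /\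
  (0 <= u -> u + w <= V%:R -> clamp V (u + w) - clamp V u = w).
Proof.
move=> w0; have V0 : 0 <= V%:R :> R by []; rewrite /clamp.
case: (lerP (u + w) 0); case: (lerP u 0); case: (lerP u V%:R);
  case: (lerP (u + w) V%:R); split; lra.
Qed.

(** Membership modulo one becomes a sum of half-line indicators, the form counted by [count_below];
    only the term [j = truncn z] can be nonzero. *)
Lemma sum_fracp_indicator al be z J : 0 <= al -> al <= be -> be <= 1 ->
  0 <= z -> z < J%:R ->
  \sum_(0 <= j < J) ((z < j%:R + be)%R%:R - (z < j%:R + al)%R%:R) =
  (al <= fracp z < be)%R%:R :> R.
Proof.
move=> al0 albe be1 z0 zJ; have /andP[f1 f2] := truncn_itv z0.
set f := Num.truncn z in f1 f2.
have fz : fracp z = z - f%:R.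
  by apply: (@fracp_def _ _ f); [rewrite pmulrn; ring|move: f2; rewrite -natr1; lra].
have fJ : (f < J)%N by rewrite -(ltr_nat R); exact: le_lt_trans zJ.
rewrite big_mkord (bigD1 (Ordinal fJ)) //= big1 ?addr0 => [|j jf].
  rewrite fz; case: (ltrP z (f%:R + be)) => h1; case: (ltrP z (f%:R + al)) => h2.
  - by rewrite subrr (_ : (al <= _) = false) //; apply/negbTE; rewrite -ltNge; lra.
  - have -> : al <= z - f%:R by lra.
    have -> : z - f%:R < be by lra.
    by rewrite subr0.
  - lra.
  - by rewrite subrr (_ : (_ < be) = false) ?andbF //; apply/negbTE; rewrite -leNgt; lra.
have : (j != f :> nat)%N by apply: contra jf => /eqP jf; apply/eqP/val_inj.
rewrite neq_ltn => /orP[jf'|jf'].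
  have h : j%:R + 1 <= f%:R :> R by rewrite natr1 ler_nat.
  have hb : j%:R + be <= z by lra.
  have ha : j%:R + al <= z by lra.
  by rewrite !ltNge hb ha subrr.
have h : f%:R + 1 <= j%:R :> R by rewrite natr1 ler_nat.
have z1 : z < f%:R + 1 by move: f2; rewrite -natr1.
have -> : z < j%:R + be by lra.
have -> : z < j%:R + al by lra.
by rewrite subrr.
Qed.

Lemma sum_ler_nat (F : nat -> R) m a : (forall j, (j < m)%N -> F j <= a) ->
  \sum_(0 <= j < m) F j <= m%:R * a.
Proof.
move=> hF; rewrite (@le_trans _ _ (\sum_(0 <= j < m) a)) //.
  by apply: ler_sum_nat => j /andP[_]; exact: hF.
by rewrite big_const_nat subn0 iter_addr_0 mulr_natl.
Qed.

(** Lifted to the line, the target interval becomes about [lam V] windows in the variable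
    [W + th W], each of length [w = de / lam] and each counted up to [2] by [count_below]. *)
Lemma count_linear_offset01 lam c th V al de : 0 < lam -> 0 <= c < 1 ->
  (forall W, 0 <= th W <= 1) -> 0 <= al -> 0 <= de -> al + de <= 1 ->
  `|\sum_(0 <= W < V) (al <= fracp (c + lam * (W%:R + th W)) < al + de)%R%:R
    - de * V%:R| <= 2 * (de / lam) + 2 * (lam * V%:R) + 4.
Proof.
move=> lam0 /andP[c0 c1] th01 al0 de0 alde.
have lV0 : 0 <= lam * V%:R by rewrite mulr_ge0 // ltW.
have /andP[m1 m2] := truncn_itv lV0; set m := Num.truncn _ in m1 m2.
pose w := de / lam; have w0 : 0 <= w by rewrite divr_ge0 // ltW.
pose u j : R := (j%:R + al - c) / lam.
pose phi j := clamp V (u j + w) - clamp V (u j).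
pose N v : R := \sum_(0 <= W < V) (W%:R + th W < v)%R%:R.
have -> : \sum_(0 <= W < V) (al <= fracp (c + lam * (W%:R + th W)) < al + de)%R%:R
    = \sum_(0 <= j < m.+2) (N (u j + w) - N (u j)).
  under [RHS]eq_bigr do rewrite -sumrB.
  rewrite exchange_big /=; apply: eq_big_nat => W /andP[_ WV].
  have /andP[t0 t1] := th01 W.
  rewrite -(@sum_fracp_indicator al (al + de) _ m.+2) //; last 3 first.
  - lra.
  - by apply: addr_ge0 => //; apply: mulr_ge0 (ltW lam0) _; apply: addr_ge0.
  - have : lam * (W%:R + th W) <= lam * V%:R.
      by rewrite ler_pM2l //; move: WV; rewrite -(ler_nat R) -natr1; lra.
    by move: m2; rewrite -(natr1 m.+1); lra.
  apply: eq_bigr => j _; have ltE v :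
      (c + lam * (W%:R + th W) < v) = (W%:R + th W < (v - c) / lam).
    by rewrite ltr_pdivlMr // [RHS]ltrBrDl mulrC.
  rewrite !ltE (_ : u j + w = (j%:R + (al + de) - c) / lam) //.
  by rewrite /u /w -mulrDl; congr (_ / _); ring.
have key j : `|N (u j + w) - N (u j) - phi j| <= 2.
  have := count_below V (u j + w) th01; have := count_below V (u j) th01.
  by rewrite -/(N _) -/(N _) /phi !ler_norml; lra.
have mV : m.+2%:R <= lam * V%:R + 2 by rewrite -2!natr1; lra.
have e1 : lam * V%:R * w = de * V%:R.
  by rewrite /w; field; exact: lt0r_neq0.
(* Upper bound: there are at most [lam V + 2] windows with at most [w + 2] points each, and the
   product expands to [de V] plus the stated error. *)
rewrite -/w ler_norml lerBrDl [X in _ && X]lerBlDr; apply/andP; split; last first.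
  apply: (@le_trans _ _ (m.+2%:R * (w + 2))).
    apply: sum_ler_nat => j _; have := key j.
    have [/andP[_] h _] := clamp_diff V (u j) w0.
    by rewrite ler_norml /phi; lra.
  apply: (@le_trans _ _ ((lam * V%:R + 2) * (w + 2))); last by lra.
  by rewrite ler_pM2r //; lra.
(* Window [0] may start below [0] and is only bounded below by [0]. Windows [1] to [m - 1] lie
   inside [[0, V]], since [c < 1] and [m <= lam V]. *)
have phi_full k : (k <= m)%N -> (k%:R - 1) * w <= \sum_(0 <= j < k) phi j.
  elim: k => [|k IHk] km; first by rewrite big_geq //; lra.
  rewrite big_nat_recr //= -natr1.
  have [/andP[h0 _] hf] := clamp_diff V (u k) w0; rewrite -/(phi k) in h0 hf.
  case: k => [|k] in km IHk h0 hf *; first by rewrite big_geq //; lra.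
  rewrite hf; first by have := IHk (ltnW km); lra.
    by rewrite divr_ge0 ?ltW // -natr1; have : 0 <= k%:R :> R by []; lra.
  rewrite /u /w -mulrDl ler_pdivrMr // [V%:R * _]mulrC.
  by move: km; rewrite -(ler_nat R) -natr1; lra.
have : \sum_(0 <= j < m.+2) phi j - m.+2%:R * 2 <=
    \sum_(0 <= j < m.+2) (N (u j + w) - N (u j)).
  rewrite lerBlDr -lerBlDl -sumrB; apply: sum_ler_nat => j _.
  by have := key j; rewrite ler_norml; lra.
have : (m%:R - 1) * w <= \sum_(0 <= j < m.+2) phi j.
  apply: le_trans (phi_full m (leqnn _)) _; rewrite big_nat_recr //= big_nat_recr //=.
  have [/andP[h0 _] _] := clamp_diff V (u m) w0.
  have [/andP[h1 _] _] := clamp_diff V (u m.+1) w0.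
  by rewrite -!/(phi _) in h0 h1; lra.
have : (lam * V%:R - 2) * w <= (m%:R - 1) * w.
  by apply: ler_wpM2r => //; move: m2; rewrite -natr1; lra.
lra.
Qed.

(** For [lam < 0], reversing the sample points by [W |-> V-1-W] changes the sign
    of the slope at the cost of an offset. *)
Lemma count_linear lam th V al de : lam != 0 ->
  (forall W, 0 <= th W <= 1) -> 0 <= al -> 0 <= de -> al + de <= 1 ->
  `|\sum_(0 <= W < V) (al <= fracp (lam * (W%:R + th W)) < al + de)%R%:R
    - de * V%:R| <= 2 * (de / `|lam|) + 2 * (`|lam| * V%:R) + 4.
Proof.
move=> lam0 th01 al0 de0 alde; case: (ltrgtP lam 0) lam0 => // lam0 _.
  rewrite (ltr0_norm lam0); pose th' W := 1 - th (V - W.+1)%N.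
  have th'01 W : 0 <= th' W <= 1 by have := th01 (V - W.+1)%N; rewrite /th'; lra.
  have := @count_linear_offset01 (- lam) (fracp (lam * V%:R)) th' V al de.
  rewrite oppr_gt0 lam0 fracp_itv => /(_ isT isT th'01 al0 de0 alde).
  rewrite big_nat_rev /=; congr (`|_ - _| <= _).
  apply: eq_big_nat => W /andP[_ WV]; rewrite add0n addrC fracpD_fracp.
  rewrite (_ : _ * (_ + _) + _ = lam * (W%:R + th W)) //.
  have e : (V - (V - W.+1).+1)%N = W by lia.
  by rewrite /th' e natrB // -natr1; ring.
rewrite (gtr0_norm lam0); have := @count_linear_offset01 lam 0 th V al de lam0.
rewrite lexx ltr01 => /(_ isT th01 al0 de0 alde).
by under eq_bigr do rewrite add0r.
Qed.
End LinearCount.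

(** * Sums over passes *)

Section Passes.
Variables (R : realType) (p idx : nat -> nat) (b : nat -> R).
Hypothesis p_gt0 : forall i, (0 < i)%N -> (0 < p i)%N.
Hypothesis p_homo : forall i, (p i <= p i.+1)%N.
Hypothesis idx_bounds : forall n, (p (idx n) <= n < p (idx n).+1)%N.
Hypothesis idx_infty : forall I, exists N, forall n, (N <= n)%N -> (I <= idx n)%N.
Hypothesis b_ge0 : forall i, 0 <= b i.

Let S i : R := \sum_(0 <= j < i) b j.

Hypothesis S_infty : forall C : R, exists I, forall i, (I <= i)%N -> C <= S i.
Hypothesis b_small : forall e : R, 0 < e ->
  exists I, forall i, (I <= i)%N -> b i <= e * S i.

(** At the ends of passes, relative errors accumulate to a small multiple of [S], the early ones
    being a constant absorbed by [S_infty]. Within a pass, monotonicity compares with both ends, and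
    [b_small] makes the pass negligible. *)
Lemma pass_cumul (f : nat -> R) : (forall j, 0 <= f j) ->
  (forall e : R, 0 < e -> exists I, forall i, (I <= i)%N ->
    `|\sum_(p i <= j < p i.+1) f j - b i| <= e * b i) ->
  forall e : R, 0 < e -> exists N, forall n, (N <= n)%N ->
    `|\sum_(1 <= j < n) f j - S (idx n)| <= e * S (idx n).
Proof.
move=> f0 hf e e0; pose A n := \sum_(1 <= j < n) f j.
have A_homo m n : (m <= n)%N -> A m <= A n.
  move=> /subnKC <-; elim: (n - m)%N => [|k IHk]; first by rewrite addn0.
  apply: le_trans IHk _; rewrite addnS /A.
  case: (leqP 1 (m + k)) => h; first by rewrite (big_nat_recr (m + k)) //= lerDl.
  by rewrite !big_geq //; lia.
have AS i : (0 < i)%N -> A (p i.+1) = A (p i) + \sum_(p i <= j < p i.+1) f j.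
  by move=> i0; rewrite /A (big_cat_nat (n := p i)) //= p_gt0.
have SS i : S i.+1 = S i + b i by rewrite /S big_nat_recr.
have cut d : 0 < d -> exists I, forall i, (I <= i)%N -> `|A (p i) - S i| <= d * S i.
  move=> d0; have [I1 h1] := hf (d / 2) ltac:(lra).
  pose I := maxn 1 I1; pose C := `|A (p I) - S I|.
  have step k : `|A (p (I + k)) - S (I + k)| <= C + d / 2 * (S (I + k) - S I).
    elim: k => [|k IHk]; first by rewrite addn0 subrr mulr0 addr0.
    have Ik : (I1 <= I + k)%N by rewrite /I; lia.
    have := h1 _ Ik; rewrite addnS SS AS; last by rewrite /I; lia.
    by move: IHk; rewrite !ler_norml; lra.
  have [I2 h2] := S_infty (2 * C / d).
  exists (maxn I I2) => i hi; have hI : (I <= i)%N by lia.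
  have := step (i - I)%N; rewrite subnKC // => hs.
  have := h2 i ltac:(lia); rewrite ler_pdivrMr // => hC.
  have SI : 0 <= d / 2 * S I by rewrite mulr_ge0 ?sumr_ge0 //; lra.
  by apply: le_trans hs _; lra.
(* The error is at most [3 d S]: one [d S] from the cut, one from [b], and one from [d * b <= b],
   which uses [d <= 1]. *)
pose d := Num.min (e / 4) 1.
have d0 : 0 < d by rewrite lt_min; lra.
have de : d <= e / 4 by rewrite ge_min lexx.
have d1 : d <= 1 by rewrite ge_min lexx orbT.
have [I1 h1] := cut d d0; have [I2 h2] := b_small d0.
have [N hN] := idx_infty (maxn I1 I2); exists N => n /hN; set i := idx n => hi.
have /andP[pn1 pn2] := idx_bounds n.
have := h1 i ltac:(lia); have := h1 i.+1 ltac:(lia); have := h2 i ltac:(lia).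
have := A_homo _ _ pn1; have := A_homo _ _ (ltnW pn2); rewrite -/i -/(A n) SS.
rewrite !ler_norml => u1 u2 u3 u4 u5.
have S0 : 0 <= S i by rewrite sumr_ge0.
have e1 : d * S i <= e / 4 * S i by rewrite ler_wpM2r.
have e2 : d * b i <= b i by rewrite -[leRHS]mul1r ler_wpM2r.
have e3 : 0 <= d * b i by rewrite mulr_ge0 // ltW.
lra.
Qed.

Lemma pass_ratio_cvg (f g : nat -> R) :
  (forall j, 0 <= f j) -> (forall j, 0 <= g j) ->
  (forall e : R, 0 < e -> exists I, forall i, (I <= i)%N ->
    `|\sum_(p i <= j < p i.+1) f j - b i| <= e * b i) ->
  (forall e : R, 0 < e -> exists I, forall i, (I <= i)%N ->
    `|\sum_(p i <= j < p i.+1) g j - b i| <= e * b i) ->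
  (fun n : nat => (\sum_(1 <= j < n.+1) f j) / \sum_(1 <= j < n.+1) g j)
    @ \oo --> (1 : R).
Proof.
move=> f0 g0 hf hg; apply/cvg_seqP => e e0.
(* Then [F] and [G] differ by at most [e s / 2], and the bound [1 / 2] gives [G >= s / 2]. *)
pose d := Num.min (e / 4) (1 / 2).
have d0 : 0 < d by rewrite lt_min; lra.
have de : d <= e / 4 by rewrite ge_min lexx.
have d1 : d <= 1 / 2 by rewrite ge_min lexx orbT.
have [N1 h1] := pass_cumul f0 hf d0; have [N2 h2] := pass_cumul g0 hg d0.
have [I3 h3] := S_infty 1; have [N3 hN3] := idx_infty I3.
exists (maxn N1 (maxn N2 N3)) => n hn.
have := h1 n.+1 ltac:(lia); have := h2 n.+1 ltac:(lia).
have := h3 _ (hN3 n.+1 ltac:(lia)).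
set s := S _; set F := \sum_(_ <= _ < _) f _; set G := \sum_(_ <= _ < _) g _.
move=> s1 hG hF; have dsG : d * s <= s / 2.
  by rewrite [leRHS]mulrC -[2^-1]div1r ler_wpM2r //; lra.
have dse : d * s <= e / 4 * s by rewrite ler_wpM2r //; lra.
have G0 : 0 < G by move: hG; rewrite ler_norml; lra.
rewrite (_ : F / G - 1 = (F - G) / G); last by field; exact: lt0r_neq0.
rewrite normrM normfV (gtr0_norm G0) ler_pdivrMr //.
have : e * (s / 2) <= e * G by rewrite ler_pM2l //; move: hG; rewrite ler_norml; lra.
by move: hG hF; rewrite !ler_norml; lra.
Qed.
End Passes.

(** * Affine images of the number *)

Lemma lev_le_blk n : (lev n <= blk n)%N.
Proof.
apply: leq_trans (level_le _) _; rewrite /pass -/(blk n).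
by have := sqrtn_bounds (blk n); case: (sqrtn (blk n)) => // m; nia.
Qed.

Lemma lev_block s o : (o <= s.*2)%N -> lev (s * s + o) = level (sqrtn s).
Proof. by move=> ho; rewrite /lev /pass blk_off. Qed.

Lemma level_sqrtn_le s : (level (sqrtn s) <= s)%N.
Proof. by have := lev_le_blk (s * s + 0); rewrite lev_block // blk_off. Qed.

(** Every word is thus preceded by a filler, where the orbit of [y] is known from that of [x]. *)
Lemma filler_last s : (0 < s)%N -> (lev (s * s).-1 <= off (s * s).-1)%N.
Proof.
case: s => // s _; have -> : (s.+1 * s.+1).-1 = (s * s + s.*2)%N by lia.
rewrite lev_block // blk_off //; apply: leq_trans (level_sqrtn_le s) _; lia.
Qed.

Lemma bases_filler n : (lev n <= off n)%N -> bases n = (n.+1)`!.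
Proof. by rewrite /bases leqNgt => /negbTE ->. Qed.

Lemma digits_filler n : (lev n <= off n)%N -> digits n = n`!.
Proof. by rewrite /digits leqNgt => /negbTE ->. Qed.

Lemma digits_lt_pred m : exists2 n, (m < n)%N & ((digits n).+1 < bases n)%N.
Proof.
exists (m.+2 * m.+2).-1; first by lia.
have := filler_last (ltn0Sn m.+1); set n := _.-1 => hn.
rewrite bases_filler // digits_filler // factS.
have n1 : (1 < n)%N by rewrite /n; lia.
by have := fact_gt0 n; move: (n`!)%N => a a0; nia.
Qed.

(** * The orbit of the number along a word *)

Section Word.
Variable s : nat.
Hypothesis s_gt0 : (0 < s)%N.
Let g := level (sqrtn s).
Let Q := g.*2.+2.
Let W := ((s - sqrtn s * sqrtn s) %% Q ^ g)%N.
Let p := (s * s).-1.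

Lemma block_letter o : (o < g)%N ->
  (bases (s * s + o) = Q) * (digits (s * s + o) = W %/ Q ^ (g - o.+1) %% Q)%N.
Proof.
move=> og; have os : (o <= s.*2)%N.
  by have := level_sqrtn_le s; rewrite -/g; lia.
rewrite /bases /digits /word /base /pass lev_block // !blk_off // -/g og.
by split.
Qed.

Lemma pred_block o : (p + o).+1 = (s * s + o)%N.
Proof. by rewrite /p -addSn prednK // muln_gt0 s_gt0. Qed.

Lemma denom_word o : (o <= g)%N -> denom bases (p + o) = (Q ^ o * denom bases p)%N.
Proof.
elim: o => [|o IHo] og; first by rewrite addn0 mul1n.
by rewrite addnS /= pred_block block_letter // IHo 1?ltnW // expnS mulnA.
Qed.

(** Letters are written most significant first, so after [o] letters the word has contributed the
    leading part [W %/ Q ^ (g - o)]. *)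
Lemma numer_word o : (o <= g)%N ->
  numer bases digits (p + o) =
  (Q ^ o * numer bases digits p + W %/ Q ^ (g - o))%N.
Proof.
elim: o => [|o IHo] og.
  by rewrite addn0 mul1n subn0 divn_small ?addn0 // ltn_mod expn_gt0.
rewrite addnS /= pred_block !block_letter // IHo 1?ltnW //.
rewrite mulnDr mulnA -expnS -addnA; congr (_ + _)%N.
rewrite [RHS](divn_eq _ Q) -divnMA -expnSr -subSn // subSS.
by rewrite [(Q * _)%N]mulnC.
Qed.

Lemma tail_word (R : realType) :
  (Q ^ g)%:R * tail R bases digits p = W%:R + tail R bases digits (p + g).
Proof.
rewrite /tail denom_word // numer_word // subnn expn0 divn1.
by rewrite natrD !natrM; ring.
Qed.
End Word.

(** * Orbit and digits of an affine image at fillers *)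

Section Affine.
Variable R : realType.
Let x : R := cantor_value R bases digits.
Local Notation tailx := (tail R bases digits).
Local Notation P n := (qprod R bases 1 n).

Lemma basic_bases : basic_sequence bases.
Proof. exact: bases_ge2. Qed.

Lemma tailx_itv n : 0 <= tailx n < 1.
Proof. exact: (tail_itv R basic_bases digits_lt digits_lt_pred). Qed.

Variables (d : nat) (a c : int) (rho sigma : R).
Hypotheses (d_gt0 : (0 < d)%N) (rho_neq0 : rho != 0).
Hypotheses (rhoE : rho = a%:~R / d%:R) (sigmaE : sigma = c%:~R / d%:R).
Let y := rho * x + sigma.

Lemma qprod_affine n : P n * y =
  (a * (numer bases digits n)%:Z + c * (denom bases n)%:Z)%:~R / d%:R
  + rho * tailx n.
Proof.
have d0 : d%:R != 0 :> R by rewrite pnatr_eq0 -lt0n.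
rewrite qprod_denom /y /tail -/x rhoE sigmaE intrD !intrM -!pmulrn; field.
exact: d0.
Qed.

(** For [n >= d], both [(n+1)!] and [n!] are multiples of [d]; hence so are [denom] and [numer] at
    [n], and the first term of [qprod_affine] is an integer. *)
Lemma filler_fracp n : (d <= n)%N -> (lev n <= off n)%N ->
  fracp (P n * y) = fracp (rho * tailx n).
Proof.
case: n => [|n] dn hn; first by rewrite leqNgt d_gt0 in dn.
have dfact : (d %| (n.+1)`!)%N by rewrite dvdn_fact // d_gt0.
have dfact' : (d %| (n.+2)`!)%N by rewrite dvdn_fact // d_gt0 ltnW.
have d0 : d%:R != 0 :> R by rewrite pnatr_eq0 -lt0n.
have /dvdnP[u eu] : (d %| numer bases digits n.+1)%N.
  by rewrite /= bases_filler // digits_filler // dvdn_addr // dvdn_mulr.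
have /dvdnP[v ev] : (d %| denom bases n.+1)%N.
  by rewrite /= bases_filler // dvdn_mulr.
rewrite qprod_affine eu ev addrC -[RHS](fracpD_int _ (a * u%:Z + c * v%:Z)).
congr (fracp (_ + _)); rewrite !intrD !intrM -!pmulrn !natrM; field.
exact: d0.
Qed.

(** The position before a filler may be a letter, so there [T_n(y) = u/d + rho T_n(x)] with only [u]
    known to be an integer. After multiplication by [(n+2)!], the term [rho (n+1)!] is large if
    [u = 0], and [(n+2)! u/d] outweighs it otherwise; a digit at most [K] is excluded either way. *)
Lemma filler_digit_gt K : exists N, forall n, (N <= n)%N -> (lev n <= off n)%N ->
  (K < cantor_digit bases y n)%N.
Proof.
have r0 : 0 < `|rho| by rewrite normr_gt0.
(* [N1] excludes [u = 0] below, and [N2] excludes [u != 0]. *)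
have [N1 h1] := nat_gt ((K.+1%:R) / `|rho|).
have [N2 h2] := nat_gt ((K.+1%:R + 2 * `|rho|) * d%:R).
exists (maxn 1 (maxn N1 N2)) => -[|n]; first by lia.
move=> Nn hn; have N1n : (N1 <= n.+1)%N by lia.
have {Nn} N2n : (N2 <= n.+2)%N by lia.
rewrite ltnNge; apply/negP => hK.
have := cantor_digit_fracp bases y n; have := fracp_itv (P n.+1 * y).
move: hK; rewrite -(ler_nat R); move: (cantor_digit bases y n.+1)%:R => D hK.
move: (fracp (P n.+1 * y)) => t ht e.
have {}e : 0 <= (bases n.+1)%:R * fracp (P n * y) < K%:R + 1.
  rewrite {2}e mulr_ge0 ?ler0n //; last by have /andP[] := fracp_itv (P n * y).
  by lra.
have d0 : 0 < d%:R :> R by rewrite ltr0n.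
pose u := a * (numer bases digits n)%:Z + c * (denom bases n)%:Z
          - d%:Z * Num.floor (P n * y).
have eu : (bases n.+1)%:R * fracp (P n * y) = (bases n.+1)%:R / d%:R * u%:~R
    + rho * ((digits n.+1)%:R + tailx n.+1).
  rewrite -tailS /fracp {1}qprod_affine /u intrB [(d%:Z * _)%:~R]intrM -pmulrn.
  by field; exact: lt0r_neq0.
have dE := digits_filler hn.
have bE : bases n.+1 = (n.+2 * (n.+1)`!)%N by rewrite bases_filler.
have F1 : 1 <= ((n.+1)`!)%:R :> R by rewrite ler1n fact_gt0.
have Fn : (n.+1)%:R <= ((n.+1)`!)%:R :> R by rewrite ler_nat fact_geq.
have := tailx_itv n.+1; rewrite eu dE bE natrM in e *.
move: (tailx n.+1) e => tl e /andP[tl0 tl1].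
move: Fn F1 e; set F := ((n.+1)`!)%:R => Fn F1 e.
have K1 : K%:R + 1 = K.+1%:R :> R by rewrite natr1.
case: (eqVneq u 0) => [u0|u0].
  have : `|rho| * n.+1%:R <= `|rho * (F + tl)|.
    rewrite normrM ler_pM2l // ger0_norm; lra.
  rewrite u0 mulr0 add0r in e; rewrite (ger0_norm (x := rho * _)); last by lra.
  have : K.+1%:R < n.+1%:R * `|rho|.
    by rewrite -ltr_pdivrMr // (lt_le_trans h1) // ler_nat.
  lra.
have nu : 1 <= `|u%:~R| :> R by rewrite -intr_norm (ler_int R 1) -gtz0_ge1 normr_gt0.
have h3 : n.+2%:R * F / d%:R <= `|n.+2%:R * F / d%:R * u%:~R|.
  rewrite normrM (ger0_norm (x := _ / _)); last first.
    by rewrite divr_ge0 ?mulr_ge0 // ltW //; lra.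
  by rewrite ler_peMr // divr_ge0 ?mulr_ge0 // ltW //; lra.
have h4 : `|rho * (F + tl)| <= `|rho| * (2 * F).
  by rewrite normrM ler_pM2l // ger0_norm; lra.
have h5 : n.+2%:R * F / d%:R <= K.+1%:R + `|rho| * (2 * F).
  apply: (le_trans h3); move: h4 e; rewrite -K1.
  move: (rho * _) (n.+2%:R * _ * _) => A B; rewrite !ler_norml; lra.
have h6 : K.+1%:R + `|rho| * (2 * F) <= (K.+1%:R + 2 * `|rho|) * F.
  have : K.+1%:R <= K.+1%:R * F by rewrite ler_peMr.
  lra.
have : (K.+1%:R + 2 * `|rho|) * d%:R < n.+2%:R.
  by rewrite (lt_le_trans h2) // ler_nat.
rewrite -(ltr_pM2r (lt_le_trans ltr01 F1)).
move: (le_trans h5 h6); rewrite ler_pdivrMr //; lra.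
Qed.

End Affine.

(** * Blocks in a constant base as intervals *)

Section BlockInterval.
Variable R : realType.

(** The number [0.b_1 b_2 ...] in base [Q], the left end of the cylinder of the block. *)
Fixpoint block_left (Q : nat) (B : seq nat) : R :=
  if B is b :: B' then (b%:R + block_left Q B') / Q%:R else 0.

Lemma block_left_itv Q B : (0 < Q)%N -> all (fun b => b < Q)%N B ->
  0 <= block_left Q B /\ block_left Q B + (Q%:R ^+ size B)^-1 <= 1.
Proof.
move=> Q0; elim: B => [|b B IHB] /=; first by rewrite expr0 invr1 add0r.
move=> /andP[bQ /IHB[h1 h2]]; have Q0R : 0 < Q%:R :> R by rewrite ltr0n.
split; first by rewrite divr_ge0 ?addr_ge0 // ?ltW.
rewrite exprS invfM [Q%:R^-1 * _]mulrC -mulrDl ler_pdivrMr // mul1r.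
by move: bQ; rewrite -(ler_nat R) -natr1; lra.
Qed.

Lemma block_interval (q : nat -> nat) (y : R) Q B m :
  (0 < Q)%N -> all (fun b => b < Q)%N B ->
  (forall l, (l < size B)%N -> q (m.+1 + l)%N = Q) ->
  (forall l, (l < size B)%N -> cantor_digit q y (m.+1 + l) = nth 0%N B l) <->
  block_left Q B <= fracp (qprod R q 1 m * y) < block_left Q B + (Q%:R ^+ size B)^-1.
Proof.
move=> Q0; have Q0R : 0 < Q%:R :> R by rewrite ltr0n.
elim: B m => [|b B IHB] m /=.
  by move=> _ _; rewrite expr0 invr1 add0r fracp_itv; split.
move=> /andP[bQ hB] hq; have [bl0 bl1] := block_left_itv Q0 hB.
have hq' l : (l < size B)%N -> q (m.+2 + l)%N = Q.
  by move=> lB; rewrite addSnnS hq.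
have {IHB hq'} := IHB m.+1 hB hq'.
have := cantor_digit_fracp q y m.
have -> : q m.+1 = Q by rewrite -[m.+1]addn0 hq.
have := fracp_itv (qprod R q 1 m.+1 * y).
move: (fracp (qprod R q 1 m.+1 * y)) (fracp (qprod R q 1 m * y)) => t' t ht' et IH.
rewrite exprS invfM [Q%:R^-1 * _]mulrC -mulrDl ler_pdivrMr // ltr_pdivlMr //.
rewrite [t * _]mulrC et; split=> [h|h].
  have -> : cantor_digit q y m.+1 = b by have := h 0%N isT; rewrite addn0.
  have /IH : forall l, (l < size B)%N -> cantor_digit q y (m.+2 + l) = nth 0%N B l.
    by move=> l lB; have := h l.+1 lB; rewrite -addSnnS.
  by lra.
have e : cantor_digit q y m.+1 = b.
  have h1 : (cantor_digit q y m.+1 < b.+1)%N by rewrite -(ltr_nat R) -natr1; lra.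
  have h2 : (b < (cantor_digit q y m.+1).+1)%N by rewrite -(ltr_nat R) -natr1; lra.
  by apply/eqP; rewrite eqn_leq -ltnS h1 -ltnS h2.
move=> [_|l lB]; first by rewrite addn0 e.
rewrite -addSnnS /=; apply: (IH.2 _) lB; move: h; rewrite e; lra.
Qed.
End BlockInterval.

(** * Regrouping sums by blocks, passes and periods *)

Section Occurrences.
Variable R : realType.

Definition occurs k (B : k.-tuple nat) (E : nat -> nat) i : bool :=
  [forall j : 'I_k, E (i + j)%N == tnth B j].

Lemma block_occ_sum k (B : k.-tuple nat) E n :
  (block_occ B E n)%:R = \sum_(1 <= i < n.+1) (occurs B E i)%:R :> R.
Proof.
rewrite /block_occ -sum1_count natr_sum big_mkcond /= /index_iota subn1.
by apply: eq_bigr => i _; rewrite -/(occurs B E i); case: occurs.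
Qed.

Lemma sum_shift (F : nat -> R) m n :
  \sum_(m <= j < m + n) F j = \sum_(0 <= i < n) F (m + i)%N.
Proof.
rewrite -{1}[m]add0n big_addn addKn.
by apply: eq_bigr => i _; rewrite addnC.
Qed.

Lemma sum_blocks (F : nat -> R) a b : (a <= b)%N ->
  \sum_(a * a <= j < b * b) F j =
  \sum_(a <= s < b) \sum_(0 <= o < s.*2.+1) F (s * s + o)%N.
Proof.
elim: b => [|b IHb]; first by case: a => // _; rewrite !big_geq.
rewrite leq_eqVlt => /predU1P[->|]; first by rewrite !big_geq.
rewrite ltnS => ab; rewrite [RHS]big_nat_recr //= -IHb //.
rewrite (big_cat_nat (n := (b * b)%N)) ?leq_mul //=.
congr (_ + _); have -> : (b.+1 * b.+1)%N = (b * b + b.*2.+1)%N by lia.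
exact: sum_shift.
Qed.

Lemma sum_pass (F : nat -> R) i :
  \sum_(i * i * (i * i) <= j < i.+1 * i.+1 * (i.+1 * i.+1)) F j =
  \sum_(0 <= t < i.*2.+1) \sum_(0 <= o < (i * i + t).*2.+1)
     F ((i * i + t) * (i * i + t) + o)%N.
Proof.
rewrite sum_blocks ?leq_mul //.
have -> : (i.+1 * i.+1)%N = (i * i + i.*2.+1)%N by lia.
exact: sum_shift.
Qed.

(** Each full period costs [err]. The incomplete last one lies between [0] and [D + err], because
    the terms are nonnegative. *)
Lemma sum_periodic (h : nat -> R) V K (D err : R) : (0 < V)%N -> 0 <= D -> 0 <= err ->
  (forall t, 0 <= h t) ->
  (forall u, `|\sum_(0 <= W < V) h (u * V + W)%N - D| <= err) ->
  `|\sum_(0 <= t < K) h t - K%:R / V%:R * D| <= K%:R / V%:R * err + D + err.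
Proof.
move=> V0 D0 err0 h0 hper; have V0R : 0 < V%:R :> R by rewrite ltr0n.
have full u : `|\sum_(0 <= t < u * V) h t - u%:R * D| <= u%:R * err.
  elim: u => [|u IHu]; first by rewrite mul0n big_geq // !mul0r subrr normr0.
  rewrite mulSnr (big_cat_nat (n := (u * V)%N)) ?leq_addr //=.
  rewrite (sum_shift _ (u * V) V); move: IHu (hper u).
  rewrite -[u.+1%:R]natr1 !ler_norml; lra.
have := divn_eq K V; have := ltn_pmod K V0.
move: (K %/ V)%N (K %% V)%N => u r rV ->.
rewrite (big_cat_nat (n := (u * V)%N)) ?leq_addr //=.
rewrite (sum_shift _ (u * V) r).
have rest : 0 <= \sum_(0 <= i < r) h (u * V + i)%N <= D + err.
  rewrite sumr_ge0 //=; apply: (@le_trans _ _ (\sum_(0 <= W < V) h (u * V + W)%N)).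
    by rewrite [leRHS](big_cat_nat (n := r)) ?(ltnW rV) //= lerDl sumr_ge0.
  by have := hper u; rewrite ler_norml; lra.
have e : (u * V + r)%:R / V%:R = u%:R + r%:R / V%:R :> R.
  by rewrite natrD natrM; field; exact: lt0r_neq0.
rewrite e; have r1 : 0 <= (r%:R / V%:R : R) <= 1.
  by rewrite divr_ge0 //= ler_pdivrMr // mul1r ler_nat ltnW.
have : 0 <= r%:R / V%:R * D <= D.
  by case/andP: r1 => r0 r1; rewrite mulr_ge0 //= -[leRHS]mul1r ler_wpM2r.
have : 0 <= r%:R / V%:R * err.
  by case/andP: r1 => r0 r1; rewrite mulr_ge0.
by move: (full u) rest; rewrite !ler_norml; lra.
Qed.

Lemma sum_geometric_le (Q : R) L : 2 <= Q -> \sum_(0 <= e < L.+1) Q ^+ e <= 2 * Q ^+ L.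
Proof.
move=> Q2; elim: L => [|L IHL]; first by rewrite big_nat1 expr0; lra.
rewrite big_nat_recr //= exprS.
have : 2 * Q ^+ L <= Q * Q ^+ L by rewrite ler_wpM2r // exprn_ge0; lra.
lra.
Qed.
End Occurrences.

(** * Frequencies of blocks *)

Lemma level_infty G : exists I, forall i, (I <= i)%N -> (G <= level i)%N.
Proof. by exists (G * G.*2.+2 ^ G)%N => i; rewrite leq_level. Qed.

Lemma sqrtn_pass i t : (t <= i.*2)%N -> sqrtn (i * i + t) = i.
Proof. by move=> ht; have [] := blk_off ht. Qed.

Lemma qprod_const (R : realType) (q : nat -> nat) j m Q :
  (forall l, (l < m)%N -> q (j + l)%N = Q) -> qprod R q j m = Q%:R ^+ m.
Proof.
elim: m => [|m IHm] hq; first by rewrite qprod0.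
by rewrite qprodS exprSr IHm ?hq // => l lm; rewrite hq // ltnW.
Qed.

Lemma qprod_ge_factor (R : realType) (q : nat -> nat) j m l : (0 < j)%N ->
  basic_sequence q -> (l < m)%N -> (q (j + l)%N)%:R <= qprod R q j m.
Proof.
move=> j0 q2; have q1 n : 1 <= (q (j + n)%N)%:R :> R.
  by rewrite ler1n (leq_trans _ (q2 _ _)) // addn_gt0 j0.
have P1 n : 1 <= qprod R q j n.
  by elim: n => [|n IHn]; rewrite ?qprod0 // qprodS mulr_ege1.
elim: m => // m IHm; rewrite ltnS leq_eqVlt qprodS => /predU1P[->|lm].
  by rewrite ler_peMl.
by rewrite (le_trans (IHm lm)) // ler_peMr // (le_trans ler01).
Qed.

Section Normality.
Variables (R : realType) (k : nat) (B : k.-tuple nat).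
Hypothesis k_gt0 : (0 < k)%N.

Let Q i := (level i).*2.+2.
Let V i := (Q i ^ level i)%N.
Let L i := (level i - k)%N.
(** The expected number of occurrences in pass [i]: [2i+1] words, [L i + 1] starting places in each,
    frequency [Q^-k] at each place. *)
Let b i : R := (i.*2.+1)%:R * (L i).+1%:R / (Q i)%:R ^+ k.

Lemma Q_gt0 i : 0 < (Q i)%:R :> R.
Proof. by rewrite ltr0n. Qed.

Lemma V_gt0 i : 0 < (V i)%:R :> R.
Proof. by rewrite ltr0n expn_gt0. Qed.

Lemma V_pow i : (k <= level i)%N -> (V i)%:R = (Q i)%:R ^+ L i * (Q i)%:R ^+ k :> R.
Proof. by move=> kl; rewrite -exprD /L subnK // /V natrX. Qed.

(** * Occurrences of a block within one pass *)

Section Counting.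
Variables (rho y : R).
Local Notation tailx := (tail R bases digits).
Local Notation P n := (qprod R bases 1 n).
Local Notation F := (cantor_digit bases y).
Hypothesis rho_neq0 : rho != 0.
Hypothesis filler_fracp_y : exists N, forall n, (N <= n)%N -> (lev n <= off n)%N ->
  fracp (P n * y) = fracp (rho * tailx n).
Hypothesis filler_digit_y : forall K, exists N, forall n, (N <= n)%N ->
  (lev n <= off n)%N -> (K < F n)%N.

Let theta i t := tailx (((i * i + t) * (i * i + t)).-1 + level i).
Let letter i t e : R :=
  (block_left R (Q i) B
    <= fracp (rho * (Q i)%:R ^+ e / (V i)%:R * ((t %% V i)%N%:R + theta i t))
    < block_left R (Q i) B + ((Q i)%:R ^+ k)^-1)%R%:R.

(** Late filler digits exceed every entry of [B], so an occurrence must lie inside a word. There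
    [block_interval] turns it into a condition on the orbit. *)
Lemma block_count : exists I, forall i, (I <= i)%N ->
  [/\ (k <= level i)%N, all (fun c => c < Q i)%N B &
  forall t, (t <= i.*2)%N ->
  let s := (i * i + t)%N in
  \sum_(0 <= o < s.*2.+1) (occurs B F (s * s + o))%:R =
  \sum_(0 <= e < (L i).+1) letter i t e].
Proof.
have [N0 hN0] := filler_fracp_y.
pose K := \max_(j < k) tnth B j; have [Nd hNd] := filler_digit_y K.
have BK c : c \in B -> (c <= K)%N.
  by case/tnthP => j ->; exact: (leq_bigmax_cond (F := fun j => tnth B j)).
have [I hI] := level_infty (maxn k K); exists (maxn 2 (maxn I (maxn N0 Nd))) => i hi.
have i2 : (2 <= i)%N by lia.
have N0i : (N0 <= i)%N by lia.
have Ndi : (Nd <= i)%N by lia.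
have := hI i ltac:(lia); rewrite geq_max => /andP[kl Kl].
have BQ : all (fun c => c < Q i)%N B.
  by apply/allP => c /BK cK; rewrite /Q; lia.
split=> // t ht s; have si : sqrtn s = i by exact: sqrtn_pass.
have le_is : (i <= s)%N by rewrite /s; nia.
have s0 : (0 < s)%N by lia.
have gs : (level i <= s.*2)%N by have := level_le i; lia.
have ss : (s <= (s * s).-1)%N by nia.
have ss' : (s <= s * s)%N by nia.
rewrite (big_cat_nat (n := (L i).+1)) ?ltnS //=; last by rewrite /L; lia.
rewrite [X in _ + X]big_nat_cond [X in _ + X]big1 ?addr0; last first.
  move=> o /andP[/andP[lo os] _]; rewrite ltnS in os.
  (* By truncated subtraction, [o + l] is the first filler offset at or after [o]. It belongs to the
     same block [s], and the occurrence would cover it. *)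
  pose l := (level i - o)%N.
  have lk : (l < k)%N by move: lo; rewrite /l /L; lia.
  have ol : (o + l <= s.*2)%N by rewrite /l; lia.
  apply/eqP; rewrite pnatr_eq0 eqb0; apply/negP => /forallP/(_ (Ordinal lk)) /=.
  have := hNd (s * s + o + l)%N ltac:(lia).
  rewrite -addnA lev_block // blk_off // si => /(_ _) h.
  have {}h : (K < F (s * s + (o + l)))%N by apply: h; rewrite /l; lia.
  by move/eqP => e; move: h; rewrite e ltnNge BK // mem_tnth.
apply: eq_big_nat => e /andP[_]; rewrite ltnS => eL.
have eg : (e + k <= level i)%N by move: eL; rewrite /L; lia.
pose p := (s * s).-1.
have [pS dp tp] : [/\ (p + e).+1 = (s * s + e)%N,
    denom bases (p + e) = (Q i ^ e * denom bases p)%N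
  & (V i)%:R * tailx p = (t %% V i)%N%:R + theta i t].
  have := pred_block s0 e; have := @denom_word s s0 e; have := tail_word s0 R.
  rewrite si -/(Q i) -/(V i) -/p => h1 h2 h3; split=> //; first by apply: h2; lia.
  by rewrite h1 /theta -/s -/p /s addKn.
(* The orbit at the filler [p] is [rho T_p(x)] modulo one, with [T_p(x) = (W + theta) / V];
   multiplication by the integer [Q^e] respects congruence modulo one. *)
have Pm : fracp (P (p + e) * y) =
    fracp (rho * (Q i)%:R ^+ e / (V i)%:R * ((t %% V i)%N%:R + theta i t)).
  rewrite -tp qprod_denom dp natrM -mulrA -fracpM_nat -qprod_denom hN0; last 2 first.
  - by rewrite /p; lia.
  - exact: filler_last.
  rewrite fracpM_nat natrX; congr fracp; field.
  by rewrite lt0r_neq0 ?V_gt0.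
rewrite /letter -Pm; congr (_%:R).
have hq l : (l < size B)%N -> bases ((p + e).+1 + l)%N = Q i.
  rewrite size_tuple => lB; rewrite pS -addnA.
  have elg : (e + l < level i)%N by lia.
  by have := @block_letter s s0 (e + l)%N; rewrite si => /(_ elg) [->].
have [] := block_interval y (isT : (0 < Q i)%N) BQ hq; rewrite size_tuple => h1 h2.
congr nat_of_bool; apply/idP/idP => [/forallP h|/h2 h].
  apply: h1 => l lB.
  by have /eqP := h (Ordinal lB); rewrite pS (tnth_nth 0%N).
apply/forallP => j; apply/eqP; by rewrite (tnth_nth 0%N) -pS h.
Qed.

(** The error of [count_linear] for slope [rho Q^e / V] and interval length [Q^-k]. *)
Let err i e : R := 2 * ((Q i)%:R ^+ (L i - e) / `|rho|)
  + 2 * (`|rho| * (Q i)%:R ^+ e) + 4.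
Let C : R := 4 / `|rho| + 4 * `|rho| + 4.

(** [theta] is not periodic in [t], but [count_linear] allows arbitrary perturbations in [[0, 1]],
    so every full period obeys the same bound. *)
Lemma letter_count i e :
  (k <= level i)%N -> all (fun c => c < Q i)%N B -> (e <= L i)%N ->
  `|\sum_(0 <= t < i.*2.+1) letter i t e
    - (i.*2.+1)%:R / (V i)%:R * (Q i)%:R ^+ L i|
    <= (i.*2.+1)%:R / (V i)%:R * err i e + (Q i)%:R ^+ L i + err i e.
Proof.
move=> kl BQ eL; have r0 : 0 < `|rho| by rewrite normr_gt0.
have [Q0 V0] := (Q_gt0 i, V_gt0 i).
have [bl0 bl1] := block_left_itv R (isT : (0 < Q i)%N) BQ.
rewrite size_tuple in bl1.
apply: sum_periodic.
- by rewrite expn_gt0.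
- by rewrite exprn_ge0 ?ler0n.
- rewrite !addr_ge0 // !mulr_ge0 // ?exprn_ge0 ?ler0n //.
  by rewrite invr_ge0.
- by move=> t; rewrite /letter ler0n.
move=> u; pose lam := rho * (Q i)%:R ^+ e / (V i)%:R.
have Qn := lt0r_neq0 Q0; have Vn := lt0r_neq0 V0.
have lam0 : lam != 0 by rewrite /lam !mulf_neq0 ?invr_neq0 ?expf_neq0.
have nlam : `|lam| = `|rho| * (Q i)%:R ^+ e / (V i)%:R.
  by rewrite !normrM normfV normrX (gtr0_norm Q0) (gtr0_norm V0).
have th01 W : 0 <= theta i (u * V i + W) <= 1.
  by have /andP[-> /ltW ->] := tailx_itv R
    (((i * i + (u * V i + W)) * (i * i + (u * V i + W))).-1 + level i).
have Qk0 : 0 <= ((Q i)%:R ^+ k)^-1 :> R by rewrite invr_ge0 exprn_ge0 ?ler0n.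
have := count_linear (V i) lam0 th01 bl0 Qk0 bl1.
have eV := V_pow kl.
have -> : ((Q i)%:R ^+ k)^-1 * (V i)%:R = (Q i)%:R ^+ L i :> R.
  by rewrite eV mulrCA mulVf ?mulr1 ?expf_neq0.
have -> : ((Q i)%:R ^+ k)^-1 / `|lam| = (Q i)%:R ^+ (L i - e) / `|rho|.
  rewrite nlam eV -[in (Q i)%:R ^+ L i](subnK eL) exprD; field.
  by rewrite !expf_neq0 ?lt0r_neq0.
have -> : `|lam| * (V i)%:R = `|rho| * (Q i)%:R ^+ e.
  by rewrite nlam divfK.
congr (`|_ - _| <= _); apply: eq_big_nat => W /andP[_ WV].
by rewrite /letter modnMDl modn_small.
Qed.

(** Both nonconstant parts of [err] are geometric in [e], so each sums to at most twice its largest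
    term. The main term carries an extra factor [L i + 1]. *)
Lemma sum_err i : \sum_(0 <= e < (L i).+1) err i e <= C * (Q i)%:R ^+ L i.
Proof.
have r0 : 0 < `|rho| by rewrite normr_gt0.
have Q2 : 2 <= (Q i)%:R :> R by rewrite (ler_nat R 2).
have h1 := sum_geometric_le (L i) Q2.
have h2 : \sum_(0 <= e < (L i).+1) (Q i)%:R ^+ (L i - e) <= 2 * (Q i)%:R ^+ L i :> R.
  apply: le_trans h1; rewrite big_nat_rev /= le_eqVlt; apply/orP; left; apply/eqP.
  apply: eq_big_nat => e eL.
  by congr (_ ^+ _); lia.
have h3 : (L i).+1%:R <= (Q i)%:R ^+ L i :> R.
  by rewrite -natrX ler_nat ltn_expl.
have h4 : \sum_(0 <= e < (L i).+1) 4 = 4 * (L i).+1%:R :> R.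
  by rewrite sumr_const_nat subn0 mulr_natr.
rewrite /err big_split big_split /= h4 -!mulr_sumr -mulr_suml.
have : (\sum_(0 <= e < (L i).+1) (Q i)%:R ^+ (L i - e)) / `|rho| <=
   2 * (Q i)%:R ^+ L i / `|rho| by rewrite ler_pM2r // invr_gt0.
have : `|rho| * (\sum_(0 <= e < (L i).+1) (Q i)%:R ^+ e) <=
   `|rho| * (2 * (Q i)%:R ^+ L i) by rewrite ler_pM2l.
rewrite /C; lra.
Qed.

Lemma pass_occurrences (eps : R) : 0 < eps -> exists I, forall i, (I <= i)%N ->
  `|\sum_(i * i * (i * i) <= j < i.+1 * i.+1 * (i.+1 * i.+1)) (occurs B F j)%:R - b i|
    <= eps * b i.
Proof.
move=> eps0; have r0 : 0 < `|rho| by rewrite normr_gt0.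
(* [4 C / eps] lets [L i + 1] outweigh the constant of [sum_err], [2 / eps] lets the number [kappa]
   of periods outweigh the incomplete one, and [1] gives [kappa >= 1]. *)
have [n hn] := nat_gt (4 * C / eps + 2 / eps + 1).
have [I1 h1] := block_count; have [I2 h2] := level_infty (n + k).
exists (maxn 1 (maxn I1 I2)) => i hi; have [kl BQ hcount] := h1 i ltac:(lia).
have ng := h2 i ltac:(lia); have nL : (n <= L i)%N by rewrite /L; lia.
have C0 : 0 <= C by rewrite /C !addr_ge0 ?divr_ge0 ?mulr_ge0 // ltW.
rewrite sum_pass (eq_big_nat _ _
  (F2 := fun t => \sum_(0 <= e < (L i).+1) letter i t e)); last first.
  by move=> t /andP[_]; rewrite ltnS; exact: hcount.
rewrite exchange_big /=.
pose kappa : R := (i.*2.+1)%:R / (V i)%:R; pose T : R := (Q i)%:R ^+ L i.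
have T0 : 0 < T by rewrite exprn_gt0 ?Q_gt0.
have eb : b i = \sum_(0 <= e < (L i).+1) kappa * T.
  rewrite sumr_const_nat subn0 -mulr_natr /b /kappa V_pow // -/T.
  by field; rewrite !expf_neq0 ?lt0r_neq0 ?Q_gt0.
rewrite {1}eb -sumrB; apply: (le_trans (ler_norm_sum _ _ _)).
apply: (@le_trans _ _ (\sum_(0 <= e < (L i).+1) (kappa * err i e + T + err i e))).
  by apply: ler_sum_nat => e /andP[_]; rewrite ltnS => eL; exact: letter_count.
have hT : \sum_(0 <= e < (L i).+1) T = T * (L i).+1%:R.
  by rewrite sumr_const_nat subn0 mulr_natr.
rewrite big_split big_split /= hT -mulr_sumr.
have -> : b i = kappa * T * (L i).+1%:R.
  by rewrite eb sumr_const_nat subn0 mulr_natr.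
have kappan : n%:R <= kappa.
  rewrite ler_pdivlMr ?V_gt0 // -natrM ler_nat.
  have := level_bound i; rewrite -/(Q i) -/(V i).
  have : (n * V i <= level i * V i)%N by rewrite leq_mul2r; apply/orP; right; lia.
  lia.
have e1 : 4 * C <= eps * (L i).+1%:R.
  have : 4 * C / eps <= (L i).+1%:R.
    have : n%:R <= (L i).+1%:R :> R by rewrite ler_nat leqW.
    have : 0 <= 2 / eps by rewrite divr_ge0 // ltW.
    lra.
  by rewrite ler_pdivrMr // [_ * eps]mulrC.
have e2 : 2 <= eps * kappa.
  have : 2 / eps <= kappa.
    have : 0 <= 4 * C / eps by rewrite divr_ge0 ?mulr_ge0 // ltW.
    lra.
  by rewrite ler_pdivrMr // [_ * eps]mulrC.
have e3 : 1 <= kappa.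
  have : 0 <= 4 * C / eps by rewrite divr_ge0 ?mulr_ge0 // ltW.
  have : 0 <= 2 / eps by rewrite divr_ge0 // ltW.
  lra.
have hs := sum_err i; rewrite -/T in hs.
set s := \sum_(_ <= _ < _) err i _ in hs *; set l := (L i).+1%:R in e1 *.
have l0 : 0 <= l by rewrite /l ler0n.
have f1 : kappa * s <= kappa * (C * T) by rewrite ler_pM2l //; lra.
have f2 : C * T <= kappa * (C * T) by rewrite ler_peMl // mulr_ge0 // ltW.
have f3 : kappa * T * (4 * C) <= kappa * T * (eps * l).
  by rewrite ler_wpM2l // mulr_ge0 // ?ltW //; lra.
have f4 : T * l * 2 <= T * l * (eps * kappa) by rewrite ler_wpM2l // mulr_ge0 // ltW.
lra.
Qed.
End Counting.

(** * Weights of the positions in a pass, and growth of their sums *)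

Lemma Q_pow_le i : (k <= level i)%N -> (level i * Q i ^ k <= i)%N.
Proof.
move=> kl; apply: leq_trans (level_bound i).
by rewrite leq_mul2l leq_pexp2l // orbT.
Qed.

(** The [L i + 1] places inside the word have weight exactly [Q^-k]. From any later place the
    product contains a filler base, at least [(s^2+1)!], and there are at most [2s+1] such
    places. *)
Lemma block_weight i t s : (2 <= i)%N -> (k <= level i)%N -> (t <= i.*2)%N ->
  s = (i * i + t)%N ->
  0 <= \sum_(0 <= o < s.*2.+1) (qprod R bases (s * s + o) k)^-1
       - (L i).+1%:R / (Q i)%:R ^+ k <= i%:R^-1.
Proof.
move=> i2 kl ht def_s; have si : sqrtn s = i by rewrite def_s sqrtn_pass.
have le_is : (i <= s)%N by nia.
have s0 : (0 < s)%N by lia.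
have gs : (level i <= s.*2)%N by have := level_le i; lia.
have ss : (0 < s * s)%N by rewrite muln_gt0 s0.
rewrite (big_cat_nat (n := (L i).+1)) ?ltnS //=; last by rewrite /L; lia.
rewrite (eq_big_nat _ _ (F2 := fun=> ((Q i)%:R ^+ k)^-1)); last first.
  move=> e /andP[_]; rewrite ltnS => eL; congr (_^-1); apply: qprod_const => l lk.
  have elg : (e + l < level i)%N by move: eL; rewrite /L; lia.
  by rewrite -addnA; have := @block_letter s s0 (e + l)%N; rewrite si => /(_ elg) [->].
rewrite sumr_const_nat subn0 -[_ *+ (L i).+1]mulr_natl.
set rest := \sum_(_ <= o < _) _.
rewrite (_ : _ + rest - _ = rest); last by rewrite addrAC subrr add0r.
have w0 o : 0 <= (qprod R bases (s * s + o) k)^-1.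
  by rewrite invr_ge0 prodr_ge0.
rewrite sumr_ge0 //=.
have f0 : 0 < ((s * s).+1`!)%:R :> R by rewrite ltr0n fact_gt0.
apply: (@le_trans _ _ (\sum_((L i).+1 <= o < s.*2.+1) (((s * s).+1`!)%:R)^-1)).
  apply: ler_sum_nat => o /andP[lo]; rewrite ltnS => os.
  pose l := (level i - o)%N.
  have lk : (l < k)%N by move: lo; rewrite /l /L; lia.
  have ol : (o + l <= s.*2)%N by rewrite /l; lia.
  have h := qprod_ge_factor R (ltn_addr o ss) basic_bases lk.
  have hf : ((s * s).+1`!)%:R <= (bases (s * s + o + l))%:R :> R.
    rewrite -addnA bases_filler; last first.
      by rewrite lev_block // blk_off // si /l; lia.
    by rewrite ler_nat leq_fact // ltnS leq_addr.
  by rewrite lef_pV2 ?posrE // ?(le_trans hf) // (lt_le_trans f0) // (le_trans hf).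
rewrite sumr_const_nat -[leLHS]mulr_natl ler_pdivrMr // mulrC.
rewrite ler_pdivlMr ?ltr0n; last by lia.
rewrite -natrM ler_nat factS; apply: (@leq_trans ((s * s).+1 * (s * s))).
  apply: (@leq_trans (s.*2.+1 * s)); first by rewrite leq_mul // leq_subr.
  nia.
by rewrite leq_mul2l fact_geq orbT.
Qed.

Lemma pass_weight (eps : R) : 0 < eps -> exists I, forall i, (I <= i)%N ->
  `|\sum_(i * i * (i * i) <= j < i.+1 * i.+1 * (i.+1 * i.+1))
      (qprod R bases j k)^-1 - b i| <= eps * b i.
Proof.
move=> eps0; have [n hn] := nat_gt eps^-1.
have [I hI] := level_infty (maxn n k); exists (maxn 2 I) => i hi.
have i2 : (2 <= i)%N by lia.
have := hI i ltac:(lia); rewrite geq_max => /andP[nl kl].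
pose c : R := (L i).+1%:R / (Q i)%:R ^+ k.
have eb : b i = \sum_(0 <= t < i.*2.+1) c.
  by rewrite sumr_const_nat subn0 -[RHS]mulr_natl /b /c mulrA.
have i0 : 0 < i%:R :> R by rewrite ltr0n; lia.
(* It suffices that [Q^k <= eps * i], which follows from [level i * Q^k <= i] once [level i] exceeds
   [1 / eps]. *)
have ic : i%:R^-1 <= eps * c.
  have Qk0 : 0 < (Q i)%:R ^+ k :> R by rewrite exprn_gt0 ?Q_gt0.
  rewrite /c mulrA ler_pdivlMr // mulrC ler_pdivrMr //.
  apply: (@le_trans _ _ (eps * i%:R)); last first.
    by rewrite ler_pM2r // ler_peMr ?ler1n // ltW.
  have : (level i * Q i ^ k)%:R <= i%:R :> R by rewrite ler_nat Q_pow_le.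
  rewrite natrM natrX -(ler_pM2l eps0); apply: le_trans.
  rewrite mulrA ler_peMl ?(ltW Qk0) // -ler_pdivrMl // mulr1.
  by rewrite (le_trans (ltW hn)) // ler_nat.
rewrite sum_pass {1}eb -sumrB; apply: (le_trans (ler_norm_sum _ _ _)).
rewrite eb mulr_sumr; apply: ler_sum_nat => t /andP[_]; rewrite ltnS => ht.
have /andP[h1 h2] := block_weight i2 kl ht erefl.
by rewrite ger0_norm // (le_trans h2).
Qed.

Lemma b_ge0 i : 0 <= b i.
Proof. by rewrite divr_ge0 ?mulr_ge0 ?exprn_ge0 ?ler0n. Qed.

(** [Q] is nondecreasing and the odd numbers [2j+1] below [2i] sum to [i^2]. *)
Lemma sum_b_ge i : (i * i)%:R / (Q i)%:R ^+ k <= \sum_(0 <= j < i) b j.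
Proof.
have odds n : (\sum_(0 <= j < n) j.*2.+1 = n * n)%N.
  by elim: n => [|n IHn]; [rewrite big_geq|rewrite big_nat_recr //= IHn; lia].
rewrite -odds natr_sum mulr_suml; apply: ler_sum_nat => j /andP[_ ji].
have Q0 n : 0 < (Q n)%:R ^+ k :> R by rewrite exprn_gt0 ?Q_gt0.
rewrite /b; apply: ler_pM; rewrite ?ler0n ?invr_ge0 ?(ltW (Q0 _)) //.
  by rewrite ler_peMr ?ler0n ?ler1n.
rewrite lef_pV2 ?posrE //; apply: lerXn2r; rewrite ?nnegrE ?ler0n // ler_nat.
by have := level_homo (ltnW ji); rewrite /Q; lia.
Qed.

Lemma sum_b_infty (C : R) :
  exists I, forall i, (I <= i)%N -> C <= \sum_(0 <= j < i) b j.
Proof.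
have [n hn] := nat_gt C; have [I hI] := level_infty (maxn 1 k).
exists (maxn n I) => i hi; have := hI i ltac:(lia); rewrite geq_max => /andP[l1 kl].
apply: le_trans (sum_b_ge i); rewrite ler_pdivlMr ?exprn_gt0 ?Q_gt0 //.
apply: (@le_trans _ _ (i%:R * (Q i)%:R ^+ k)).
  rewrite ler_pM2r ?exprn_gt0 ?Q_gt0 // (le_trans (ltW hn)) // ler_nat; lia.
rewrite -natrX -natrM ler_nat leq_mul2l.
by apply/orP; right; apply: leq_trans (Q_pow_le kl); rewrite leq_pmull.
Qed.

Lemma b_small (eps : R) : 0 < eps ->
  exists I, forall i, (I <= i)%N -> b i <= eps * \sum_(0 <= j < i) b j.
Proof.
move=> eps0; have [n hn] := nat_gt (3 / eps).
have [I hI] := level_infty (maxn 1 n); exists (maxn 1 I) => i hi.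
have i1 : (1 <= i)%N by lia.
have := hI i ltac:(lia); rewrite geq_max => /andP[l1 nl].
have Qk0 : 0 < (Q i)%:R ^+ k :> R by rewrite exprn_gt0 ?Q_gt0.
apply: (@le_trans _ _ (eps * ((i * i)%:R / (Q i)%:R ^+ k))); last first.
  by rewrite ler_pM2l // sum_b_ge.
rewrite /b mulrA ler_pM2r ?invr_gt0 //.
have g0 : 0 < (level i)%:R :> R by rewrite ltr0n.
(* The ratio of [b i] to the lower bound of [sum_b_ge] is at most [3 / level i], because
   [L i + 1 <= V] and [level i * V <= i]. *)
have h : (i.*2.+1 * (L i).+1 * level i <= 3 * (i * i))%N.
  have : ((L i).+1 * level i <= i)%N.
    apply: leq_trans (level_bound i); rewrite mulnC leq_mul2l.
    rewrite (@leq_trans (level i).+1) ?orbT //; first by rewrite /L ltnS leq_subr.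
    exact: ltn_expl.
  nia.
rewrite -(ler_pM2r g0); apply: (@le_trans _ _ (3 * (i * i)%:R)).
  by rewrite -!natrM ler_nat.
rewrite mulrAC ler_pM2r ?ltr0n ?muln_gt0 ?i1 //.
have : 3 / eps <= (level i)%:R by rewrite (le_trans (ltW hn)) // ler_nat.
by rewrite ler_pdivrMr // mulrC.
Qed.

Lemma pass_bounds n :
  (pass n * pass n * (pass n * pass n) <= n <
   (pass n).+1 * (pass n).+1 * ((pass n).+1 * (pass n).+1))%N.
Proof.
have /andP[h1 h2] := sqrtn_bounds n; have /andP[h3 h4] := sqrtn_bounds (sqrtn n).
rewrite /pass /blk (leq_trans (leq_mul h3 h3)) //=.
by rewrite (leq_trans h2) // leq_mul.
Qed.

Lemma pass_infty I : exists N, forall n, (N <= n)%N -> (I <= pass n)%N.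
Proof. by exists (I * I * (I * I))%N => n hn; rewrite /pass /blk !leq_sqrtn. Qed.

Lemma block_frequency (rho y : R) : rho != 0 ->
  (exists N, forall n, (N <= n)%N -> (lev n <= off n)%N ->
     fracp (qprod R bases 1 n * y) = fracp (rho * tail R bases digits n)) ->
  (forall K, exists N, forall n, (N <= n)%N -> (lev n <= off n)%N ->
     (K < cantor_digit bases y n)%N) ->
  (fun n : nat => (block_occ B (cantor_digit bases y) n)%:R / Qsum R bases k n)
    @ \oo --> (1 : R).
Proof.
move=> rho0 hfr hdig.
rewrite (_ : (fun n => _) = fun n : nat =>
    (\sum_(1 <= j < n.+1) (occurs B (cantor_digit bases y) j)%:R) /
     \sum_(1 <= j < n.+1) (qprod R bases j k)^-1); last first.
  by apply/funext => n; rewrite block_occ_sum.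
apply: (@pass_ratio_cvg R (fun i => i * i * (i * i))%N pass b).
- by move=> i i0; rewrite !muln_gt0 i0.
- by move=> i; rewrite !leq_mul.
- exact: pass_bounds.
- exact: pass_infty.
- exact: b_ge0.
- exact: sum_b_infty.
- exact: b_small.
- by move=> j; rewrite ler0n.
- by move=> j; rewrite invr_ge0 prodr_ge0.
- by move=> e e0; exact: (pass_occurrences rho0 hfr hdig e0).
- exact: pass_weight.
Qed.
End Normality.

(** * Failure of uniform distribution *)

Section NonUniform.
Variables (R : realType) (rho y : R).
Local Notation tailx := (tail R bases digits).
Local Notation P n := (qprod R bases 1 n).
Hypothesis filler_fracp_y : exists N, forall n, (N <= n)%N -> (lev n <= off n)%N ->
  fracp (P n * y) = fracp (rho * tailx n).

Lemma tail_filler n : (lev n.+1 <= off n.+1)%N -> tailx n <= 2 / n.+2%:R.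
Proof.
move=> hn; have := tailS R bases digits n; rewrite bases_filler // digits_filler //.
have /andP[_ t1] := tailx_itv R n.+1; rewrite factS natrM => e.
have F0 : 1 <= (n.+1`!)%:R :> R by rewrite ler1n fact_gt0.
rewrite ler_pdivlMr ?ltr0n // -(ler_pM2r (lt_le_trans ltr01 F0)).
by rewrite [tailx n * _]mulrC mulrAC e; lra.
Qed.

Lemma filler_fracp_small : exists N, forall n, (N <= n)%N ->
  (1 / 4 <= fracp (P n * y) < 3 / 4) -> (off n < lev n)%N || (off n.+1 < lev n.+1)%N.
Proof.
(* The bound [8 |rho|] makes [|rho| * 2 / (n+2)] less than [1/4], so between two fillers the orbit
   stays within [1/4] of an integer. *)
have [N0 h0] := filler_fracp_y; have [N1 h1] := nat_gt (8 * `|rho|).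
exists (maxn N0 N1) => n hn; apply: contraTT; rewrite negb_or -!leqNgt => /andP[f1 f2].
rewrite h0 //; last by lia.
have /andP[t0 _] := tailx_itv R n; have t2 := tail_filler f2.
have nz : `|rho * tailx n| < 1 / 4.
  rewrite normrM (ger0_norm t0); apply: (@le_lt_trans _ _ (`|rho| * (2 / n.+2%:R))).
    by rewrite ler_wpM2l.
  rewrite mulrA ltr_pdivrMr ?ltr0n //.
  have : N1%:R <= n.+2%:R :> R by rewrite ler_nat; lia.
  lra.
move: nz; rewrite ltr_norml; set z := rho * _ => nz.
case: (ltrP z 0) => z0.
  rewrite (@fracp_def _ z (-1) (z + 1)); last 2 first.
  - by rewrite intrN; ring.
  - lra.
  by apply/negP => /andP[_]; lra.
rewrite fracp_small; last by lra.
by apply/negP => /andP[]; lra.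
Qed.

(** The [u^2] blocks below [u^4] hold at most [u] letters each, so letters have density zero. *)
Lemma sum_letters u :
  \sum_(0 <= n < u * u * (u * u)) (off n < lev n)%N%:R <= (u * u * u)%:R :> R.
Proof.
rewrite -[X in \sum_(X <= _ < _) _](mul0n 0) sum_blocks //.
apply: (@le_trans _ _ (\sum_(0 <= s < u * u) u%:R)); last first.
  by rewrite sumr_const_nat subn0 -[leLHS]mulr_natl -natrM.
apply: ler_sum_nat => s /andP[_ su].
have gu : (level (sqrtn s) <= u)%N.
  by apply: leq_trans (level_le _) _; rewrite ltnW // ltnNge leq_sqrtn -ltnNge.
rewrite (eq_big_nat _ _ (F2 := fun o => (o < level (sqrtn s))%N%:R)); last first.
  by move=> o /andP[_]; rewrite ltnS => os; rewrite lev_block // blk_off.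
apply: (@le_trans _ _ (level (sqrtn s))%:R); last by rewrite ler_nat.
elim: (s.*2.+1) => [|m IHm]; first by rewrite big_geq // ler0n.
rewrite big_nat_recr //=; case: (ltnP m (level (sqrtn s))) => hm; last by rewrite addr0.
rewrite (eq_big_nat _ _ (F2 := fun=> 1)) ?sumr_const_nat ?subn0.
  by rewrite natr1 ler_nat.
by move=> o /andP[_ om]; rewrite (ltn_trans om hm).
Qed.

Lemma not_distribution_normal : ~ distribution_normal_numbers bases y.
Proof.
rewrite /distribution_normal_numbers /= => /(_ (1 / 4) (3 / 4)).
move=> /(_ ltac:(lra) ltac:(lra) ltac:(lra)) /cvg_seqP /(_ (1 / 8) ltac:(lra)) [N hN].
have [N1 h1] := filler_fracp_small.
pose bad n : R := (1 / 4 <= fracp (P n * y) < 3 / 4)%R%:R.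
pose letter_at n : R := (off n < lev n)%N%:R.
have badP n : bad n <= (n < N1)%N%:R + (letter_at n + letter_at n.+1).
  rewrite /bad /letter_at; case: (ltnP n N1) => nN1.
    have : 0 <= (off n < lev n)%N%:R :> R by rewrite ler0n.
    have : 0 <= (off n.+1 < lev n.+1)%N%:R :> R by rewrite ler0n.
    by case: (_ <= _ < _) => /=; lra.
  case: (boolP (_ <= _ < _)) => [/(h1 _ nN1)/orP[->|->]|_] /=.
  - by rewrite add0r lerDl ler0n.
  - by rewrite add0r lerDr ler0n.
  - by rewrite !addr_ge0 // ler0n.
have sumN m : \sum_(0 <= n < m) (n < N1)%N%:R <= N1%:R :> R.
  elim: m => [|m IHm]; first by rewrite big_geq // ler0n.
  rewrite big_nat_recr //=; case: (ltnP m N1) => hm; last by rewrite addr0.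
  rewrite (eq_big_nat _ _ (F2 := fun=> 1)) ?sumr_const_nat ?subn0.
    by rewrite natr1 ler_nat.
  by move=> o /andP[_ om]; rewrite (ltn_trans om hm).
have sumS m : \sum_(0 <= n < m) letter_at n.+1 <= \sum_(0 <= n < m) letter_at n + 1.
  have e : letter_at 0%N + \sum_(0 <= n < m) letter_at n.+1 =
      \sum_(0 <= n < m) letter_at n + letter_at m.
    by rewrite -big_nat_recr // -big_nat_recl.
  have : 0 <= letter_at 0%N by rewrite /letter_at ler0n.
  have : letter_at m <= 1 by rewrite /letter_at lern1 leq_b1.
  by lra.
(* The interval should receive half of the [M = u^4] points, hence at least [3/8] of them within
   tolerance [1/8]. With [u >= N1 + 17], the bound [N1 + 2 u^3 + 1] is at most [M / 4]. *)
pose u := (N + N1 + 17)%N; pose M := (u * u * (u * u))%N.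
have uM : (u <= M)%N by rewrite /M /u; nia.
have := hN M ltac:(rewrite /u in uM; lia).
have -> : (count (fun n => 1 / 4 <= fracp (P n * y) < 3 / 4) (iota 0 M))%:R
    = \sum_(0 <= n < M) bad n :> R.
  rewrite -sum1_count natr_sum big_mkcond /= /index_iota subn0.
  by apply: eq_bigr => n _; rewrite /bad; case: (_ <= _ < _).
have hbad : \sum_(0 <= n < M) bad n <= N1%:R + 2 * (u * u * u)%:R + 1.
  apply: (le_trans (ler_sum_nat (fun n _ => badP n))).
  rewrite !big_split /=.
  by move: (sumN M) (sumS M) (sum_letters u); rewrite -/M -/(letter_at _); lra.
have M0 : 0 < M%:R :> R by rewrite ltr0n /M /u; lia.
rewrite ler_norml => /andP[+ _]; rewrite lerBrDl => h.
have : 3 / 8 * M%:R <= \sum_(0 <= n < M) bad n.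
  by rewrite -ler_pdivlMr //; lra.
have h2 : (8 * (N1 + 2 * (u * u * u) + 1) <= 2 * M)%N by rewrite /M /u; nia.
move: hbad h2; move: (u * u * u)%N => c hbad; rewrite -(ler_nat R).
by rewrite [(8 * _)%:R]natrM [(2 * M)%:R]natrM [(_ + 1)%:R]natrD
  [(N1 + _)%:R]natrD [(2 * c)%:R]natrM; lra.
Qed.
End NonUniform.

(** * Assembly, with the product of the two denominators as common denominator of [r] and [s] *)

Theorem mainTheorem2 (R : realType) :
  exists (q : nat -> nat) (x : R),
    [/\ basic_sequence q,
        total_recursive q,
        computable_real x,
        0 <= x < 1
      & forall r s : rat, r != 0 ->
          (normal_numbers q `\` distribution_normal_numbers q)
            (ratr r * x + ratr s)].
Proof.
exists bases, (cantor_value R bases digits); split.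
- exact: basic_bases.
- exact: total_recursive_bases.
- apply: computable_cantor_value => //.
  + exact: basic_bases.
  + exact: digits_lt.
  + exact: digits_lt_pred.
  + exact: bases_even.
  + exact: total_recursive_bases.
  + exact: total_recursive_digits.
- exact: (cantor_value_itv R basic_bases digits_lt digits_lt_pred).
move=> r s r0; set y := _ + _.
have rho0 : ratr r != 0 :> R by rewrite fmorph_eq0.
pose d1 := `|denq r|%N; pose d2 := `|denq s|%N.
have e1 : denq r = d1%:Z by rewrite /d1 gez0_abs.
have e2 : denq s = d2%:Z by rewrite /d2 gez0_abs.
have d10 : (0 < d1)%N by rewrite absz_gt0 denq_neq0.
have d20 : (0 < d2)%N by rewrite absz_gt0 denq_neq0.
have d0 : (0 < d1 * d2)%N by rewrite muln_gt0 d10.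
have d1n : d1%:R != 0 :> R by rewrite pnatr_eq0 -lt0n.
have d2n : d2%:R != 0 :> R by rewrite pnatr_eq0 -lt0n.
have rE : ratr r = (numq r * d2%:Z)%:~R / (d1 * d2)%:R :> R.
  rewrite /ratr e1 intrM natrM -!pmulrn; field; exact/andP.
have sE : ratr s = (numq s * d1%:Z)%:~R / (d1 * d2)%:R :> R.
  rewrite /ratr e2 intrM natrM -!pmulrn; field; exact/andP.
have hfr : exists N, forall n, (N <= n)%N -> (lev n <= off n)%N ->
    fracp (qprod R bases 1 n * y) = fracp (ratr r * tail R bases digits n).
  by exists (d1 * d2)%N => n dn hn; exact: (filler_fracp d0 rE sE dn hn).
split; last exact: not_distribution_normal hfr.
exists (Num.floor y), (cantor_digit bases y); split.
  exact: (cantor_expansionP basic_bases).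
move=> k B k0; apply: (block_frequency B k0 rho0 hfr) => K.
exact: (filler_digit_gt d0 rho0 rE sE).
Qed.
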